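(* Fix $k\geq 3$. For $n,m_1,m_2\in\mathbb{Z}^+$ with $1\leq m_1,m_2\leq n$ and $m_1\neq m_2$, \[\frac{n^2f_k(m_1,m_2,n)}{f_k(n)}=\varphi_k\left(\frac{m_1}{n}\right)\varphi_k\left(1-\frac{m_2}{n}\right)\left(1+O_k\left(n^{-0.49}\right)\right).\]
   Context: For $w\in S_n$, a $k$-descent of $w$ starts at index $i$ (with $1\le i\le n-k+1$) if $w(i)>w(i+1)>\cdots>w(i+k-1)$. $f_k(n)$ is the number of $w\in S_n$ with no $k$-descent, and $f_k(m_1,m_2,n)$ is the number of such $w$ with $w(1)=m_1$ and $w(n)=m_2$. The constant $r_k>0$ is the one in the known theorem of Ehrenborg, Kitaev and Perry: for each $k\ge2$ there are real $c_k>0$, $r_k>0$, $0\le\gamma_k<1$ with $f_k(n)=n!\,c_k\,r_k^n(1+O_k(\gamma_k^n))$ (this determines $r_k$ uniquely). Define \[\varphi_k(x)=\frac{1}{r_k}\left(1-\frac{(x/r_k)^{k-1}}{(k-1)!}+\frac{(x/r_k)^k}{k!}-\frac{(x/r_k)^{2k-1}}{(2k-1)!}+\frac{(x/r_k)^{2k}}{(2k)!}-\cdots\right).\] $O_k(g(n))$ denotes a quantity bounded in absolute value by $Kg(n)$ for all sufficiently large $n$, where $K$ (and the threshold) depends only on $k$; in particular the bound is uniform in $m_1,m_2$. *)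

(* Defs.v *)
From HB Require Import structures.
From mathcomp Require Import all_boot all_order all_algebra all_fingroup.
From mathcomp Require Import all_classical all_reals all_analysis.
Set Implicit Arguments.
Unset Strict Implicit.
Unset Printing Implicit Defensive.
Import Order.TTheory GRing.Theory Num.Theory.
Import numFieldNormedType.Exports.

(* Permutations act on {0, .., n-1}: position a and value w a stand for the
   1-based position a+1 and value w(a+1). *)

(* The k entries at positions i, .., i+k-1 exist and are strictly decreasing. *)
Definition descent_at (k n : nat) (w : 'S_n) (i : nat) : bool :=
  (i + k <= n)%N &&
  [forall a : 'I_n, forall b : 'I_n,
     [&& (i <= a)%N, val b == a.+1 & (b < i + k)%N] ==> (w b < w a)%N].

Definition descent_free (k n : nat) (w : 'S_n) : bool :=
  [forall i : 'I_n, ~~ descent_at k w i].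

Definition fcount (k n : nat) : nat := #|[set w : 'S_n | descent_free k w]|.

(* m1 and m2 are 1-based values. *)
Definition starts_with (n : nat) (w : 'S_n) (m1 : nat) : bool :=
  [forall a : 'I_n, (val a == 0) ==> ((w a).+1 == m1)].

Definition ends_with (n : nat) (w : 'S_n) (m2 : nat) : bool :=
  [forall a : 'I_n, (a.+1 == n) ==> ((w a).+1 == m2)].

Definition fcount_ends (k m1 m2 n : nat) : nat :=
  #|[set w : 'S_n | [&& descent_free k w, starts_with w m1 & ends_with w m2]]|.

Local Open Scope ring_scope.

(* r is the constant r_k of the Ehrenborg-Kitaev-Perry asymptotics
   f_k(n) = n! c_k r_k^n (1 + O(gamma_k^n)), which determines r uniquely. *)
Definition is_growth_rate (R : realType) (k : nat) (r : R) : Prop :=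
  0 < r /\
  exists c gamma : R,
    [/\ 0 < c, 0 <= gamma, gamma < 1 &
      exists (K : R) (N : nat), forall n : nat, (N <= n)%N ->
        exists e : R, `|e| <= K * gamma ^+ n /\
          (fcount k n)%:R = n`!%:R * c * r ^+ n * (1 + e)].

(* Coefficients of 1 - y^(k-1)/(k-1)! + y^k/k! - y^(2k-1)/(2k-1)! + ...
   The two cases are disjoint for k >= 2. *)
Definition phi_coeff (R : realType) (k : nat) (i : nat) : R :=
  if (k %| i)%N then (i`!%:R)^-1
  else if (k %| i.+1)%N then - (i`!%:R)^-1
  else 0.

Definition phi (R : realType) (k : nat) (r x : R) : R :=
  r^-1 * limn (pseries (phi_coeff R k) (x / r)).

(* Main.v *)
Require Import Defs.
From HB Require Import structures.
From mathcomp Require Import all_boot all_order all_algebra all_fingroup.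
From mathcomp Require Import all_classical all_reals all_analysis.
From mathcomp Require Import ring lra zify.
Import Order.TTheory GRing.Theory Num.Theory.
Import numFieldNormedType.Exports.
Local Open Scope ring_scope.
Set Implicit Arguments.
Unset Strict Implicit.
Unset Printing Implicit Defensive.

(** The asymptotics come from an exact formula for the number of words with
    prescribed ends.

    Cut a word into consecutive decreasing blocks, and give a block of length
    [a] the weight [1] if [a = 1 mod k], [-1] if [a = 0 mod k] and [0]
    otherwise.  Since [1 - x + x^k - x^(k+1) + ... = (1 - x) / (1 - x^k)] is
    the inverse of [1 + x + ... + x^(k-1)], the sum over all cuttings of the
    product of the weights is [1] when every decreasing run is shorter than
    [k] and [0] otherwise.  Splitting off just the first and the last block
    gives [descfree_two_sided].  Summed over the permutations with first value
    [m1] and last value [m2], the prescribed values constrain only these two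
    blocks ([m1] is the maximum of the first one, [m2] the minimum of the last
    one), and what lies between is an arbitrary descent-free arrangement.  So
    [f_k(m1, m2, n)] is a signed sum of [N(i, j) f_k(n - i - j - 2)], where
    [N(i, j)] counts the pairs of disjoint blocks of lengths [i + 1] and
    [j + 1] ([fcount_ends_formula]).

    As [N(i, j)] is close to [C(m1, i) C(n - m2, j)] and
    [f_k(n - M) / f_k(n)] is close to [(r n)^(-M)], each term of the formula,
    multiplied by [n^2 / f_k(n)], is within [O(Q^(i+j) / (i! j! n))] of the
    product of the [i]-th term of the series [phi (m1 / n)] and the [j]-th
    term of [phi (1 - m2 / n)] ([term_estimate]).  Summation gives an additive
    error [O(1 / n)], uniformly in [m1] and [m2] ([ends_estimate]).

    An additive error is a relative one as soon as [phi] is bounded below by a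
    positive constant on [[0, 1]] ([phi_ge]).  Let
    [alpha_n = f_k(n) / (n! r^n)] ([scaled_count]), which stays between two positive constants
    [c0] and [C0], and [G(z) = sum alpha_n z^n] for [0 < z < 1].  Splitting
    off only the first block gives [G = alpha_0 + W G] with
    [W'(z) = phi(z)], hence [alpha_0 G' = phi G^2].  Comparison with the
    geometric series bounds [G] above by [C0 / (1 - z)] and [G'] below by
    [c0 / (1 - z)^2]; the powers of [1 - z] cancel and [phi >= c0^2 / C0^2] on
    [(0, 1)].  The Lipschitz bound for [phi] carries this to the end points. *)

(** * Words without long descents *)

(** The weight of a decreasing block of length [i + 1]. Writing it as a
    difference makes the sums of consecutive weights telescope; as the two
    terms are not both nonzero for [1 < k], it takes the values
    [1], [-1] and [0]. *)
Definition block_sign (R : pzRingType) (k i : nat) : R :=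
  (k %| i)%N%:R - (k %| i.+1)%N%:R.

(** Both ends of the telescoping sum are divisible by [k] together when
    [k <= L]; for [L < k] the lower end is [0] and [L] is not divisible. *)
Lemma sum_block_sign (R : pzRingType) (k L : nat) : (0 < L)%N ->
  \sum_(L - k <= i < L) block_sign R k i = (L < k)%N%:R.
Proof.
move=> L0; rewrite /block_sign.
have /(telescope_sumr (fun i => - ((k %| i)%N%:R : R))) : (L - k <= L)%N.
  exact: leq_subr.
under eq_bigr do rewrite opprK addrC.
move=> ->; rewrite opprK addrC.
case: (ltnP L k) => [Lk|kL].
  rewrite (eqP (ltnW Lk : (L - k == 0)%N)) dvdn0.
  by rewrite gtnNdvd //= subr0.
by rewrite dvdn_subl // subrr.
Qed.

Section DescentFreeWords.
Variables (T : Type) (gt : rel T) (k : nat).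
Implicit Types t s : seq T.

Fixpoint first_run t : nat :=
  if t is x :: t' then
    if t' is y :: _ then if gt x y then (first_run t').+1 else 1%N else 1%N
  else 0%N.

Lemma leq_first_run a t :
  (a <= first_run t)%N = (a <= size t)%N && sorted gt (take a t).
Proof.
elim: t a => [|x t IH] [|a] //.
case: t IH => [|y t] IH; first by case: a.
have := IH a; rewrite [first_run [:: x, y & t]]/= -/(first_run (y :: t)).
case: ifP => gxy; first by rewrite ltnS => ->; case: a => //= a; rewrite gxy.
by case: a => [|a] _ //=; rewrite gxy andbF.
Qed.

Lemma first_run_size t : (first_run t <= size t)%N.
Proof. by have := leq_first_run (first_run t) t; rewrite leqnn => /esym/andP[]. Qed.

Lemma first_run_gt0 t : (0 < first_run t)%N = (0 < size t)%N.
Proof. by rewrite leq_first_run; case: t => //= x t; rewrite take0. Qed.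

Lemma first_run_drop a t : (a < first_run t)%N ->
  first_run (drop a t) = (first_run t - a)%N.
Proof.
elim: t a => [|x t IH] [|a] //; rewrite ?drop0 ?subn0 //.
case: t IH => [|y t] IH //.
rewrite [first_run [:: x, y & t]]/= -/(first_run (y :: t)).
by case: ifP => // gxy; rewrite ltnS => /IH.
Qed.

Fixpoint descfree t : bool :=
  if t is x :: t' then (first_run t < k)%N && descfree t' else true.

Lemma descfree_cons x t :
  descfree (x :: t) = (first_run (x :: t) < k)%N && descfree t.
Proof. by []. Qed.

Hypothesis k_gt1 : (1 < k)%N.

(** A window of [k] decreasing letters starting inside the first run and
    leaving it would have to cross an ascent, so only the length of this run
    and the word after it matter. *)
Lemma descfree_run t : (0 < size t)%N ->
  descfree t = (first_run t < k)%N && descfree (drop (first_run t) t).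
Proof.
elim: t => // x [|y t] IH _ //; rewrite descfree_cons IH //.
rewrite [first_run [:: x, y & t]]/= -/(first_run (y :: t)).
case: ifP => gxy; last by rewrite /= k_gt1 -IH.
by rewrite /= andbA; congr andb; lia.
Qed.

Lemma descfree_drop_run a t : (a < first_run t)%N ->
  descfree (drop a t)
  = (first_run t - a < k)%N && descfree (drop (first_run t) t).
Proof.
move=> at_; rewrite descfree_run; last first.
  by rewrite size_drop subn_gt0 (leq_trans at_) // first_run_size.
by rewrite first_run_drop // drop_drop subnK // ltnW.
Qed.

(** Cutting the first run, of length [L], after [i + 1] letters leaves a run
    of length [L - i - 1] in front of the same remaining word, so all nonzero
    terms carry the same factor, and their weights are summed by
    [sum_block_sign]. *)
Lemma descfree_front (R : pzRingType) t : (0 < size t)%N ->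
  (descfree t)%:R = \sum_(i < size t) block_sign R k i *
     (sorted gt (take i.+1 t) && descfree (drop i.+1 t))%:R.
Proof.
move=> t0; set L := first_run t; have L0 : (0 < L)%N by rewrite first_run_gt0.
have Lt : (L <= size t)%N := first_run_size t.
rewrite -(big_mkord xpredT (fun i => block_sign R k i *
     (sorted gt (take i.+1 t) && descfree (drop i.+1 t))%:R)).
rewrite (big_cat_nat (leq0n L)) //= [X in _ + X]big_nat [X in _ + X]big1 ?addr0; last first.
  move=> i /andP[Li it]; have := leq_first_run i.+1 t.
  by rewrite ltnNge Li it => /= <-; rewrite mulr0.
rewrite (big_cat_nat (leq0n (L - k)) (leq_subr _ _)) /=.
have E i : (i < L)%N -> (sorted gt (take i.+1 t) && descfree (drop i.+1 t))
    = (L - k <= i)%N && descfree (drop L t).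
  move=> iL; have := leq_first_run i.+1 t; rewrite -/L iL => /esym/andP[_ ->].
  have [/= iL'|] := ltnP i.+1 L; first by rewrite descfree_drop_run // -/L; congr andb; lia.
  move=> Li; have -> : L = i.+1 by lia.
  by have -> : (i.+1 - k <= i)%N by lia.
rewrite big_nat big1 ?add0r; last first.
  by move=> i /andP[_ iLk]; rewrite E 1?leqNgt ?iLk ?mulr0 //; lia.
rewrite (eq_big_nat _ _ (F2 := fun i => block_sign R k i * (descfree (drop L t))%:R)).
  by rewrite -mulr_suml sum_block_sign // descfree_run // -natrM mulnb.
by move=> i /andP[Li iL]; rewrite E // Li.
Qed.

(** This characterisation is invariant under reversal, unlike the recursive
    definition. *)
Lemma descfreeP t : reflect
  (forall s1 s2 s3, t = s1 ++ s2 ++ s3 -> size s2 = k -> ~~ sorted gt s2)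
  (descfree t).
Proof.
apply: (iffP idP) => [|H].
  move=> + s1 s2 s3 tE s2k; rewrite {}tE.
  elim: s1 => [|x s1 IH]; last by rewrite cat_cons descfree_cons => /andP[_ /IH].
  case: s2 s2k => [|y s2] s2k; first by move: k_gt1; rewrite -s2k.
  rewrite cat0s cat_cons descfree_cons -cat_cons => /andP[+ _].
  by rewrite ltnNge leq_first_run take_size_cat // size_cat s2k leq_addr.
elim: t H => // x t IH H; rewrite descfree_cons; apply/andP; split; last first.
  by apply: IH => s1 s2 s3 tE; apply: (H (x :: s1) s2 s3); rewrite tE.
rewrite ltnNge leq_first_run; apply/negP => /andP[kt].
apply/negP/(H [::] _ (drop k (x :: t))); first by rewrite cat0s cat_take_drop.
by rewrite size_takel.
Qed.

End DescentFreeWords.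

Lemma descfree_rev (T : Type) (gt : rel T) k t : (1 < k)%N ->
  descfree gt k (rev t) = descfree (fun x y => gt y x) k t.
Proof.
move=> k1; apply/(descfreeP _ k1)/(descfreeP _ k1) => H s1 s2 s3 tE s2k.
  rewrite -rev_sorted; apply: (H (rev s3) _ (rev s1)); last by rewrite size_rev.
  by rewrite tE !rev_cat catA.
rewrite -[s2]revK rev_sorted; apply: (H (rev s3) _ (rev s1)).
  by rewrite -[t]revK tE !rev_cat catA.
by rewrite size_rev.
Qed.

Section TwoSided.
Variables (T : Type) (gt : rel T) (k : nat).
Hypothesis k_gt1 : (1 < k)%N.
Variable R : comPzRingType.
Implicit Types t : seq T.

Lemma descfree_back t : (0 < size t)%N ->
  (descfree gt k t)%:R = \sum_(j < size t) block_sign R k j *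
     (descfree gt k (take (size t - j.+1) t) && sorted gt (drop (size t - j.+1) t))%:R.
Proof.
move=> t0; rewrite -[t in LHS]revK descfree_rev // descfree_front ?size_rev //.
apply: eq_bigr => j _; congr (_ * _); rewrite andbC take_rev drop_rev.
by rewrite rev_sorted -descfree_rev // revK.
Qed.

(** The first and last blocks are split off in turn; the separate term is the
    case where a single block is the whole word. *)
Lemma descfree_two_sided t : (0 < size t)%N ->
  (descfree gt k t)%:R = block_sign R k (size t).-1 * (sorted gt t)%:R
  + \sum_(i < size t) \sum_(j < size t | (i + j + 2 <= size t)%N)
      block_sign R k i * block_sign R k j *
      ((sorted gt (take i.+1 t))%:R *
       (descfree gt k (take (size t - j.+1 - i.+1) (drop i.+1 t)))%:R *
       (sorted gt (drop (size t - j.+1) t))%:R).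
Proof.
move=> t0; rewrite descfree_front //; case nE : (size t) => [|n]; first by rewrite nE in t0.
rewrite big_ord_recr [in RHS]big_ord_recr /= [LHS]addrC.
rewrite -nE drop_size take_size /= andbT; congr (_ * _ + _).
rewrite nE [X in _ = _ + X]big1 ?addr0; last by move=> j /= ?; exfalso; lia.
apply: eq_bigr => i _; have iln := ltn_ord i.
have it : (0 < size (drop i.+1 t))%N by rewrite size_drop nE; lia.
rewrite -mulnb natrM descfree_back // size_drop nE.
have -> : (n.+1 - i.+1 = n - i)%N by lia.
rewrite mulr_sumr mulr_sumr.
rewrite (eq_bigl (fun j : 'I_n.+1 => j < n - i)%N); last first.
  by move=> j /=; lia.
rewrite (big_ord_widen n.+1 (fun j => block_sign R k i * ((sorted gt (take i.+1 t))%:R *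
   (block_sign R k j *
    (descfree gt k (take (n - i - j.+1) (drop i.+1 t)) &&
     sorted gt (drop (n - i - j.+1) (drop i.+1 t)))%:R)))); last by lia.
apply: eq_bigr => j ji; rewrite -mulnb natrM drop_drop.
have -> : (n.+1 - j.+1 - i.+1 = n - i - j.+1)%N by lia.
have -> : (n - i - j.+1 + i.+1 = n.+1 - j.+1)%N by lia.
by ring.
Qed.

End TwoSided.

(** * Sums over the arrangements of a finite set *)

Section Arrangements.
Variable T : finType.
Implicit Types (A S : {set T}) (t : seq T).

Definition arrangements A : seq (seq T) := permutations (enum A).

Lemma mem_arrangements A t :
  (t \in arrangements A) = uniq t && ([set x in t] == A).
Proof.
rewrite mem_permutations; apply/idP/andP => [tA|[tu /eqP <-]].
  split; first by rewrite (perm_uniq tA) enum_uniq.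
  by apply/eqP/setP => x; rewrite inE (perm_mem tA) mem_enum.
by apply: uniq_perm => //; [exact: enum_uniq | move=> x; rewrite mem_enum inE].
Qed.

Lemma size_arrangement A t : t \in arrangements A -> size t = #|A|.
Proof. by rewrite mem_permutations => /perm_size ->; rewrite -cardE. Qed.

(** An arrangement is determined by the set [S] of its first [p] letters and
    an arrangement of each of [S] and its complement. *)
Lemma big_arrangements_split (R : nmodType) A p (F : seq T -> seq T -> R) :
  (p <= #|A|)%N ->
  \sum_(t <- arrangements A) F (take p t) (drop p t) =
  \sum_(S : {set T} | (S \subset A) && (#|S| == p))
    \sum_(t1 <- arrangements S) \sum_(t2 <- arrangements (A :\: S)) F t1 t2.
Proof.
move=> pA; rewrite big_seq.
rewrite (partition_big (fun t => [set x in take p t])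
          (fun S => (S \subset A) && (#|S| == p))) /=; last first.
  move=> t tA; have tp : size (take p t) = p.
    by rewrite size_takel // (size_arrangement tA).
  move: tA; rewrite mem_arrangements => /andP[tu /eqP <-].
  apply/andP; split; first by apply/fintype.subsetP => x; rewrite !inE; exact: mem_take.
  by rewrite cardsE (card_uniqP _) ?tp // take_uniq.
apply: eq_bigr => S /andP[SA /eqP Sp].
rewrite -big_filter; transitivity (\sum_(t <- [seq t1 ++ t2 |
    t1 <- arrangements S, t2 <- arrangements (A :\: S)]) F (take p t) (drop p t)).
  apply/perm_big/uniq_perm; first exact/filter_uniq/permutations_uniq.
    apply: allpairs_uniq; [exact: permutations_uniq | exact: permutations_uniq |].
    move=> /= _ _ /allpairsP[[a1 a2] [/= a1S _ ->]] /allpairsP[[b1 b2] [/= b1S _ ->]] /=.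
    move/eqP; rewrite eqseq_cat; last by rewrite !(@size_arrangement S).
    by move=> /andP[/eqP -> /eqP ->].
  move=> t; rewrite mem_filter; apply/idP/allpairsP => [/andP[/andP[tA] /eqP tS] _|].
    exists (take p t, drop p t); rewrite /= cat_take_drop; split=> //.
      rewrite mem_arrangements tS eqxx andbT take_uniq //.
      by move: tA; rewrite mem_arrangements => /andP[].
    move: tA; rewrite mem_arrangements -{1 2}(cat_take_drop p t) cat_uniq.
    move=> /andP[/and3P[_ /hasPn dj ud] /eqP <-].
    rewrite mem_arrangements ud -tS; apply/eqP/setP => x; rewrite !inE mem_cat.
    case xd: (x \in drop p t); last by rewrite orbF andNb.
    by rewrite orbT andbT; move: (dj _ xd) => ->.
  move=> [[t1 t2] /= [t1S t2S ->]].
  have s1 : size t1 = p by rewrite (size_arrangement t1S).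
  move: t1S t2S; rewrite !mem_arrangements take_size_cat //.
  move=> /andP[u1 /eqP e1] /andP[u2 /eqP e2]; rewrite e1 eqxx andbT /=.
  have tA : uniq (t1 ++ t2) && ([set x in t1 ++ t2] == A).
    rewrite cat_uniq u1 u2 andbT /=; apply/andP; split.
      apply/hasPn => x xt2; have : x \in [set x in t2] by rewrite inE.
      by rewrite e2 -e1 !inE => /andP[].
    apply/eqP/setP => x; rewrite inE mem_cat.
    move/setP/(_ x): e1; rewrite inE => ->; move/setP/(_ x): e2; rewrite !inE => ->.
    by have /fintype.subsetP/(_ x) := SA; case: (x \in S) => //= ->.
  by rewrite tA.
rewrite big_allpairs_dep; apply: eq_big_seq => t1 t1S; apply: eq_bigr => t2 _.
by rewrite take_size_cat ?drop_size_cat // (size_arrangement t1S).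
Qed.

Lemma big_arrangements_split_last (R : nmodType) A q (F : seq T -> seq T -> R) :
  (q <= #|A|)%N ->
  \sum_(t <- arrangements A) F (take (#|A| - q) t) (drop (#|A| - q) t) =
  \sum_(S : {set T} | (S \subset A) && (#|S| == q))
    \sum_(t1 <- arrangements (A :\: S)) \sum_(t2 <- arrangements S) F t1 t2.
Proof.
move=> qA; rewrite big_arrangements_split ?leq_subr //.
have DD S : S \subset A -> A :\: (A :\: S) = S.
  by move=> /finset.setIidPr SA; rewrite finset.setDDr finset.setDv finset.set0U.
rewrite (reindex_onto (fun S => A :\: S) (fun S => A :\: S)) /=; last first.
  by move=> S /andP[/DD].
apply: eq_big => [S|S /andP[_ /eqP ->]] //.
apply/idP/idP => [/andP[/andP[_ /eqP cS] /eqP <-]|/andP[SA /eqP Sq]].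
  by rewrite finset.subsetDl cardsD (finset.setIidPr (finset.subsetDl _ _)) cS subKn /=.
by rewrite DD // eqxx finset.subsetDl cardsD (finset.setIidPr SA) Sq eqxx.
Qed.

(** Relates arrangements to permutations of indices; [e] lists [A] in an
    order that the caller chooses. *)
Lemma big_arrangements_perm (R : nmodType) A n (e : n.-tuple T)
    (F : seq T -> R) : perm_eq e (enum A) ->
  \sum_(t <- arrangements A) F t =
  \sum_(w : 'S_n) F [seq tnth e (w i) | i <- enum 'I_n].
Proof.
move=> eA; pose h (w : 'S_n) := [seq tnth e (w i) | i <- enum 'I_n].
rewrite -(big_map h xpredT F); apply/perm_big/uniq_perm.
- exact: permutations_uniq.
- rewrite map_inj_uniq; first by rewrite /index_enum -enumT enum_uniq.
  move=> u v /eq_in_map uv; apply/permP => i; have := uv i (mem_enum _ i).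
  have /tuple_uniqP inj : uniq e by rewrite (perm_uniq eA) enum_uniq.
  by move=> /inj.
- move=> t; rewrite mem_permutations -(permPr eA).
  apply/(tuple_permP (t := e))/mapP => [[p tp]|[p _ tp]]; exists p => //.
  by rewrite mem_index_enum.
Qed.

End Arrangements.

(** * Decreasing arrangements and their extreme values *)

Definition ord_gt n : rel 'I_n := fun x y => (y < x)%N.

Lemma ord_gt_trans n : transitive (@ord_gt n).
Proof. by move=> y x z; rewrite /ord_gt => yx zy; apply: ltn_trans zy yx. Qed.

Lemma sorted_enum_ord n (S : {set 'I_n}) :
  sorted (fun x y : 'I_n => (x < y)%N) (enum S).
Proof.
rewrite /enum_mem -enumT; apply: sorted_filter; first by move=> y x z; apply: ltn_trans.
by rewrite -(sorted_map (f := val) (e' := ltn)) val_enum_ord iota_ltn_sorted.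
Qed.

Lemma sorted_rev_enum_ord n (S : {set 'I_n}) : sorted (@ord_gt n) (rev (enum S)).
Proof. by rewrite rev_sorted; exact: sorted_enum_ord. Qed.

Lemma big_arrangements_sorted (R : pzSemiRingType) n (S : {set 'I_n})
    (F : seq 'I_n -> R) :
  \sum_(t <- arrangements S) (sorted (@ord_gt n) t)%:R * F t = F (rev (enum S)).
Proof.
have revS : rev (enum S) \in arrangements S.
  by rewrite mem_permutations perm_rev.
rewrite (bigD1_seq (rev (enum S))) ?permutations_uniq //=.
rewrite sorted_rev_enum_ord mul1r big_seq_cond big1 ?addr0 // => t /andP[tS].
case: (boolP (sorted _ t)) => [st|]; last by rewrite mul0r.
case/eqP; apply: (sorted_eq (@ord_gt_trans n)) => //.
- by move=> x y; rewrite /ord_gt; case: ltngtP.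
- exact: sorted_rev_enum_ord.
- by move: tS; rewrite mem_permutations => /perm_trans; apply; rewrite perm_sym perm_rev.
Qed.

Lemma ohead_sorted (T : eqType) (r : rel T) t x : transitive r -> irreflexive r ->
  sorted r t -> (ohead t == Some x) = (x \in t) && all (fun y => (y == x) || r x y) t.
Proof.
move=> rT rI; case: t => //= y t yt; have /allP yall := order_path_min rT yt.
apply/eqP/andP => [[<-]|[+ /andP[/orP[/eqP ->//|rxy] _]]].
  by rewrite inE !eqxx; split=> //=; apply/allP => z /yall ->; rewrite orbT.
rewrite inE => /predU1P[-> //|/yall ryx].
by have := rT _ _ _ rxy ryx; rewrite rI.
Qed.

(** With [B] the set of smaller (greater) values, these are the blocks of
    length [i + 1] with maximum (minimum) [x]. *)
Definition pointed_subsets (T : finType) (x : T) (B : {set T}) i : {set {set T}} :=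
  [set S : {set T} | [&& x \in S, S :\ x \subset B & #|S| == i.+1]].

Lemma card_pointed_subsets (T : finType) (x : T) (B : {set T}) i :
  x \notin B -> #|pointed_subsets x B i| = 'C(#|B|, i).
Proof.
move=> xB; rewrite -cards_draws.
have xS (S : {set T}) : S \subset B -> x \notin S.
  by move=> /fintype.subsetP SB; apply: contra xB => /SB.
have -> : pointed_subsets x B i = (fun S => x |: S) @:
    [set S : {set T} | (S \subset B) && (#|S| == i)].
  apply/setP => S; rewrite inE; apply/and3P/imsetP => [[xinS SB /eqP cS]|].
    exists (S :\ x); last by rewrite finset.setD1K.
    by rewrite inE SB /= -eqSS -cS (cardsD1 x S) xinS add1n.
  move=> [S']; rewrite inE => /andP[S'B /eqP cS'] ->.
  by rewrite setU11 setU1K ?xS // S'B cardsU1 xS // cS'.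
rewrite card_in_imset // => S1 S2; rewrite !inE => /andP[/xS x1 _] /andP[/xS x2 _] E.
by rewrite -(setU1K x1) E setU1K.
Qed.

Definition below n (x : 'I_n) : {set 'I_n} := [set y : 'I_n | (y < x)%N].
Definition above n (x : 'I_n) : {set 'I_n} := [set y : 'I_n | (x < y)%N].

Lemma card_below n (x : 'I_n) : #|below x| = x.
Proof.
rewrite cardsE -sum1_card -(big_ord_widen n (fun _ => 1%N)) ?sum1_card ?card_ord //.
exact/ltnW/ltn_ord.
Qed.

Lemma card_above n (x : 'I_n) : #|above x| = (n - x.+1)%N.
Proof.
have -> : above x = ~: (x |: below x).
  by apply/setP => y; rewrite !inE negb_or -leqNgt ltn_neqAle [x == y :> nat]eq_sym.
by rewrite cardsCs finset.setCK cardsU1 card_below inE ltnn card_ord.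
Qed.

Lemma ohead_rev_enum n (x : 'I_n) (S : {set 'I_n}) :
  (ohead (rev (enum S)) == Some x) = (x \in S) && (S :\ x \subset below x).
Proof.
rewrite (@ohead_sorted _ (@ord_gt n)); [|exact: ord_gt_trans|by move=> y; exact: ltnn|
  exact: sorted_rev_enum_ord].
rewrite mem_rev mem_enum all_rev; congr andb.
apply/allP/fintype.subsetP => [H y|H y].
  rewrite !inE => /andP[/negbTE yx yS]; have := H y.
  by rewrite mem_enum yx => /(_ yS).
by have := H y; rewrite mem_enum !inE; case: eqP => //= _ H' yS; exact: H'.
Qed.

Lemma ohead_enum n (x : 'I_n) (S : {set 'I_n}) :
  (ohead (enum S) == Some x) = (x \in S) && (S :\ x \subset above x).
Proof.
rewrite (@ohead_sorted _ (fun x y : 'I_n => x < y)%N);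
  [|by move=> a b c; exact: ltn_trans|by move=> y; exact: ltnn|exact: sorted_enum_ord].
rewrite mem_enum; congr andb.
apply/allP/fintype.subsetP => [H y|H y].
  rewrite !inE => /andP[/negbTE yx yS]; have := H y.
  by rewrite mem_enum yx => /(_ yS).
by have := H y; rewrite mem_enum !inE; case: eqP => //= _ H' yS; exact: H'.
Qed.

(** * Exact formulas for the two counts *)

(** An increasing relabelling of the values preserves descents, so the
    descent-free arrangements of any [m]-element set are as numerous as the
    descent-free permutations of [m] letters. *)
Lemma descfree_perm k n m (e : m.-tuple 'I_n) (w : 'S_m) : (1 < k)%N ->
  (forall a b : 'I_m, (tnth e a < tnth e b)%N = (a < b)%N) ->
  descfree (@ord_gt n) k [seq tnth e (w i) | i <- enum 'I_m] = descent_free k w.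
Proof.
move=> k1 e_mono; set t := map _ _.
have st : size t = m by rewrite size_map size_enum_ord.
have nth_t x0 (a : 'I_m) : nth x0 t a = tnth e (w a).
  by rewrite (nth_map a) ?size_enum_ord // nth_ord_enum.
have atE i : descent_at k w i = (i + k <= m)%N && sorted (@ord_gt n) (take k (drop i t)).
  rewrite /descent_at; case: leqP => //= ikm.
  have im : (i < m)%N by lia.
  pose x0 := tnth e (Ordinal im).
  have szk : size (take k (drop i t)) = k by rewrite size_takel // size_drop st; lia.
  apply/'forall_forallP/(sortedP x0) => [H j|H a b].
    rewrite szk => jk.
    have jm : (i + j < m)%N by lia.
    have jm' : ((i + j).+1 < m)%N by lia.
    have bnd : [&& i <= i + j, (i + j).+1 == (i + j).+1 & (i + j).+1 < i + k]%N.
      by rewrite leq_addr eqxx -addnS ltn_add2l.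
    have /implyP/(_ bnd) wlt := H (Ordinal jm) (Ordinal jm').
    rewrite !nth_take ?(ltnW jk) // !nth_drop addnS.
    rewrite (nth_t x0 (Ordinal jm)) (nth_t x0 (Ordinal jm')).
    by rewrite /ord_gt e_mono.
  apply/implyP => /and3P[ia /eqP ba bik]; have := H (a - i)%N.
  rewrite szk !nth_take ?nth_drop; try lia.
  have -> : (i + (a - i).+1 = b)%N by lia.
  rewrite subnKC // !nth_t /ord_gt e_mono; apply; lia.
apply/(descfreeP _ k1)/forallP => [H i|H s1 s2 s3 tE s2k].
  rewrite atE; apply/negP => /andP[ikm]; apply/negP.
  apply: (H (take i t) _ (drop k (drop i t))); first by rewrite !cat_take_drop.
  by rewrite size_takel // size_drop st; lia.
have im : (size s1 < m)%N by rewrite -st tE !size_cat; lia.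
have := H (Ordinal im); rewrite atE /= tE drop_size_cat // take_size_cat //.
by rewrite -st tE !size_cat s2k addnA leq_addr.
Qed.

Lemma sum_descfree (R : pzSemiRingType) k n (M : {set 'I_n}) : (1 < k)%N ->
  \sum_(t <- arrangements M) (descfree (@ord_gt n) k t)%:R
  = (fcount k #|M|)%:R :> R.
Proof.
move=> k1; rewrite (big_arrangements_perm (e := enum_tuple M)) //.
rewrite /fcount -sum1dep_card natr_sum [RHS]big_mkcond.
apply: eq_bigr => w _; rewrite descfree_perm //; first by case: descent_free.
have mono (a b : 'I_#|M|) : (a < b)%N ->
    (tnth (enum_tuple M) a < tnth (enum_tuple M) b)%N.
  rewrite !(tnth_nth (enum_default a)) => ab; have tr : transitive (fun x y : 'I_n => x < y)%N.
    by move=> y x z; apply: ltn_trans.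
  by apply: (sorted_ltn_nth tr _ (sorted_enum_ord M)); rewrite // inE size_tuple.
move=> a b; case: (ltngtP a b) => [/mono //|/mono|/val_inj ->]; last by rewrite ltnn.
by case: ltngtP.
Qed.

(** Renewal equation: the first block is any set of [i + 1] values. *)
Lemma fcount_rec (R : comPzRingType) k n : (1 < k)%N -> (0 < n)%N ->
  (fcount k n)%:R = \sum_(i < n) block_sign R k i *
     ('C(n, i.+1)%:R * (fcount k (n - i.+1))%:R).
Proof.
move=> k1 n0; have cT : #|[set: 'I_n]| = n by rewrite cardsT card_ord.
rewrite -[in LHS]cT -sum_descfree // big_seq.
under eq_bigr => t tT.
  have st : size t = n by rewrite (size_arrangement tT).
  rewrite descfree_front // ?st //.
  over.
rewrite -big_seq exchange_big; apply: eq_bigr => i _ /=; have ilt := ltn_ord i.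
rewrite -mulr_sumr; congr (_ * _).
rewrite (big_arrangements_split (fun t1 t2 =>
  (sorted (@ord_gt n) t1 && descfree (@ord_gt n) k t2)%:R)) ?cT //.
rewrite (eq_bigr (fun=> (fcount k (n - i.+1))%:R)); last first.
  move=> S /andP[_ /eqP cS].
  under eq_bigr do under eq_bigr do rewrite -mulnb natrM.
  under eq_bigr do rewrite -mulr_sumr sum_descfree //.
  rewrite (big_arrangements_sorted _ (fun=> _)); congr (fcount k _)%:R.
  by rewrite finset.setTD cardsCs finset.setCK cS card_ord.
rewrite sumr_const -[LHS]mulr_natl; congr (_%:R * _).
have := cards_draws [set: 'I_n] i.+1; rewrite cT => <-.
by apply: eq_card => S; rewrite inE.
Qed.

(** The number of pairs of disjoint blocks that can begin and end a word with
    first value [x] and last value [y]. *)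
Definition pointed_pairs n (x y : 'I_n) i j : nat :=
  \sum_(S in pointed_subsets x (below x) i)
    #|[set T in pointed_subsets y (above y) j | T \subset ~: S]|.

Lemma pointed_pairs_le n (x y : 'I_n) i j :
  (pointed_pairs x y i j <= 'C(x, i) * 'C(n - y.+1, j))%N.
Proof.
rewrite -[in leqRHS](card_below x) -(card_pointed_subsets (x := x)) ?inE ?ltnn //.
rewrite -sum_nat_const.
apply: leq_sum => S _; rewrite -(card_above y) -(card_pointed_subsets (x := y)) ?inE ?ltnn //.
by apply/subset_leq_card/fintype.subsetP => T; rewrite inE => /andP[].
Qed.

(** Blocks [S] avoiding [y] are chosen first; the values of [S] are then
    excluded from the last block, at most [i + 1] of them. *)
Lemma pointed_pairs_ge n (x y : 'I_n) i j : x != y ->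
  ('C(x.-1, i) * 'C(n - y.+1 - i.+1, j) <= pointed_pairs x y i j)%N.
Proof.
move=> xy; have nx : x \notin below x :\ y by rewrite !inE ltnn andbF.
apply: (@leq_trans (#|pointed_subsets x (below x :\ y) i| * 'C(n - y.+1 - i.+1, j))%N).
  rewrite card_pointed_subsets // leq_mul2r; apply/orP; right.
  apply: leq_bin2l; have := cardsD1 y (below x); rewrite card_below.
  by case: (y \in _) => /= ->; rewrite ?add1n //= add0n leq_pred.
rewrite -sum_nat_const /pointed_pairs [leqRHS](big_setID (pointed_subsets x (below x :\ y) i)) /=.
apply: leq_trans (leq_addr _ _).
have -> : pointed_subsets x (below x) i :&: pointed_subsets x (below x :\ y) i
    = pointed_subsets x (below x :\ y) i.
  apply/setP => S; rewrite !inE; case: (x \in S) => //=.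
  case: (#|S| == _) => //=; rewrite ?andbF // !andbT andb_idl //.
  by move=> /fintype.subset_trans; apply; apply: subD1set.
apply: leq_sum => S; rewrite inE => /and3P[xS Sbelow /eqP cS].
have yS : y \notin S.
  apply/negP => yS; have /fintype.subsetP/(_ y) := Sbelow.
  by rewrite !inE eqxx yS eq_sym xy => /(_ isT).
have nyB : y \notin above y :\: S by rewrite !inE ltnn andbF.
apply: (@leq_trans #|pointed_subsets y (above y :\: S) j|).
  rewrite card_pointed_subsets //; apply: leq_bin2l.
  rewrite cardsD card_above; apply: leq_sub2l.
  by rewrite -cS; apply/subset_leq_card/fintype.subsetP => z; rewrite inE => /andP[].
apply/subset_leq_card/fintype.subsetP => T; rewrite !inE => /and3P[yT Ty ->].
rewrite yT andbT /=; apply/andP; split.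
  apply: fintype.subset_trans Ty _; apply: finset.subsetDl.
apply/fintype.subsetP => z zT; rewrite inE; have [->//|zy] := eqVneq z y.
by have /fintype.subsetP/(_ z) := Ty; rewrite !inE zy zT => /(_ isT)/andP[].
Qed.

(** The boolean accounts for a single block that fills the whole word: it is
    [true] when [x] and [y] are the ends of the decreasing word. *)
Lemma fcount_ends_formula (R : comPzRingType) k n (x y : 'I_n) : (1 < k)%N ->
  exists b : bool, (fcount_ends k x.+1 y.+1 n)%:R =
    block_sign R k n.-1 * b%:R +
    \sum_(i < n) \sum_(j < n | (i + j + 2 <= n)%N)
      block_sign R k i * block_sign R k j *
      ((pointed_pairs x y i j)%:R * (fcount k (n - (i + j + 2)))%:R).
Proof.
move=> k1; have n0 : (0 < n)%N by exact: leq_ltn_trans (ltn_ord x).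
have cT : #|[set: 'I_n]| = n by rewrite cardsT card_ord.
pose first t : R := (ohead t == Some x)%:R.
pose final t : R := (ohead (rev t) == Some y)%:R.
exists ((ohead (rev (enum [set: 'I_n])) == Some x) && (ohead (enum [set: 'I_n]) == Some y)).
have -> : (fcount_ends k x.+1 y.+1 n)%:R = \sum_(t <- arrangements [set: 'I_n])
    (descfree (@ord_gt n) k t)%:R * (first t * final t).
  rewrite (big_arrangements_perm (e := ord_tuple n)); last first.
    apply: uniq_perm; [exact: enum_uniq | exact: enum_uniq |].
    by move=> z; rewrite mem_enum inE; exact: (mem_enum 'I_n z).
  rewrite /fcount_ends -sum1dep_card natr_sum big_mkcond; apply: eq_bigr => w _.
  rewrite descfree_perm //; last by move=> a b; rewrite !tnth_ord_tuple.
  rewrite -!natrM !mulnb.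
  set t := map _ _; have st : size t = n by rewrite size_map size_enum_ord.
  have oheadE s : size s = n -> ohead s = Some (nth x s 0).
    by case: s => //= n0'; rewrite -n0' in n0.
  have nth_t (a : 'I_n) : nth x t a = w a.
    by rewrite (nth_map a) ?size_enum_ord // nth_ord_enum tnth_ord_tuple.
  have hx : (ohead t == Some x) = starts_with w x.+1.
    rewrite oheadE // (nth_t (Ordinal n0)).
    apply/eqP/forallP => [[<-] a|/(_ (Ordinal n0)) /eqP[/val_inj -> //]].
    by apply/implyP => /eqP a0; rewrite (_ : a = Ordinal n0) //; exact: val_inj.
  have hy : (ohead (rev t) == Some y) = ends_with w y.+1.
    have n1 : (n - 1 < n)%N by lia.
    rewrite oheadE ?size_rev // nth_rev st // (nth_t (Ordinal n1)).
    have n1E : (Ordinal n1).+1 == n by rewrite /=; lia.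
    apply/eqP/forallP => [[<-] a|/(_ (Ordinal n1))/implyP/(_ n1E)/eqP[/val_inj -> //]].
      apply/implyP => /eqP a0; rewrite (_ : a = Ordinal n1) //; apply: val_inj => /=; lia.
  by rewrite hx hy; case: ifP.
rewrite big_seq.
under eq_bigr => t tT.
  have st : size t = n by rewrite (size_arrangement tT).
  rewrite descfree_two_sided // ?st // mulrDl mulr_suml.
  under eq_bigr do rewrite mulr_suml.
  over.
rewrite -big_seq big_split /=; congr (_ + _).
  under eq_bigr do rewrite -mulrA.
  rewrite -mulr_sumr (big_arrangements_sorted _ (fun t => first t * final t)).
  by rewrite /first /final revK -natrM mulnb.
rewrite exchange_big; apply: eq_bigr => i _ /=.
rewrite exchange_big; apply: eq_bigr => j ijn /=.
pose A t := (sorted (@ord_gt n) t)%:R : R.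
pose D t := (descfree (@ord_gt n) k t)%:R : R.
pose G t1 t2 := A t1 * first t1 * (D (take (n - i.+1 - j.+1) t2) *
   (A (drop (n - i.+1 - j.+1) t2) * final (drop (n - i.+1 - j.+1) t2))).
rewrite big_seq (eq_bigr (fun t => block_sign R k i * block_sign R k j *
   G (take i.+1 t) (drop i.+1 t))); last first.
  move=> t /size_arrangement; rewrite cT => st.
  have hE : first t = first (take i.+1 t).
    by rewrite /first; case: (t) st n0 => // <-.
  have lE : final t = final (drop (n - j.+1) t).
    rewrite /final -{1}(cat_take_drop (n - j.+1) t) rev_cat.
    case/lastP E : (drop (n - j.+1) t) => [|s z]; last by rewrite rev_rcons.
    by move: (congr1 size E); rewrite size_drop st /=; lia.
  rewrite /G drop_drop (_ : n - i.+1 - j.+1 + i.+1 = n - j.+1)%N; last lia.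
  rewrite (_ : n - i.+1 - j.+1 = n - j.+1 - i.+1)%N; last lia.
  by rewrite -hE -lE /A /D; ring.
rewrite -big_seq -mulr_sumr; congr (_ * _).
rewrite (big_arrangements_split G) ?cT //.
rewrite /pointed_pairs natr_sum mulr_suml big_mkcond [RHS]big_mkcond /=.
apply: eq_bigr => S _; rewrite finset.subsetT [S \in _]inE /=.
case: eqP => cS; last by rewrite !andbF.
rewrite /G -big_distrlr /= (big_arrangements_sorted _ first) andbT {1}/first ohead_rev_enum.
case: (_ && _); last by rewrite mul0r.
have cM : #|[set: 'I_n] :\: S| = (n - i.+1)%N.
  by rewrite finset.setTD cardsCs finset.setCK cS card_ord.
have jM : (j.+1 <= #|[set: 'I_n] :\: S|)%N by rewrite cM; lia.
have := big_arrangements_split_last (fun u v => D u * (A v * final v)) jM.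
rewrite cM => ->; rewrite mul1r -sum1dep_card natr_sum mulr_suml.
rewrite big_mkcond [RHS]big_mkcond; apply: eq_bigr => T _ /=.
rewrite [T \in _]inE finset.setTD; case: eqP => cT'; rewrite ?andbF //= !andbT.
rewrite andbC; case TS: (T \subset ~: S); rewrite ?andbF ?andbT //.
rewrite -big_distrlr /= (big_arrangements_sorted _ final) /D sum_descfree //.
rewrite /final revK ohead_enum mul1r.
have -> : #|~: S :\: T| = (n - (i + j + 2))%N.
  rewrite cardsD (finset.setIidPr TS) cT' -finset.setTD cM; lia.
by case: ifP => _; rewrite ?mulr1 ?mulr0.
Qed.

Local Open Scope classical_set_scope.

(** * Elementary estimates *)

Section ElementaryBounds.
Variable R : realType.
Implicit Types a b x y z : R.

Lemma exp_partial_sum_le x n : 0 <= x -> \sum_(i < n) x ^+ i / i`!%:R <= expR x.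
Proof.
move=> x0; rewrite -(big_mkord xpredT (fun i => x ^+ i / i`!%:R)).
apply: (nondecreasing_cvgn_le (u_ := series (exp_coeff x))).
  apply/nondecreasing_seqP => m; rewrite /series /= big_nat_recr //= lerDl.
  exact: exp_coeff_ge0.
exact: is_cvg_series_exp_coeff.
Qed.

Lemma subr_expr_le a b n : 0 <= b -> b <= a -> a <= 1 ->
  a ^+ n - b ^+ n <= n%:R * (a - b).
Proof.
move=> b0 ba a1; have a0 : 0 <= a by exact: le_trans ba.
elim: n => [|n IH]; first by rewrite !expr0 subrr mul0r.
have -> : a ^+ n.+1 - b ^+ n.+1 = a * (a ^+ n - b ^+ n) + (a - b) * b ^+ n.
  by rewrite !exprS; ring.
have bn1 : b ^+ n <= 1 by rewrite exprn_ile1 // (le_trans ba).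
have d0 : 0 <= a ^+ n - b ^+ n by rewrite subr_ge0 lerXn2r // nnegrE.
rewrite -natr1 [leRHS]mulrDl mul1r lerD //.
  by apply: le_trans IH; rewrite ler_piMl.
by rewrite ler_piMr // subr_ge0.
Qed.

Lemma expr_bernoulli x n : 0 <= x -> x <= 1 ->
  x ^+ n * (1 + n%:R * (1 - x)) <= 1.
Proof.
move=> x0 x1; elim: n => [|n IH]; first by rewrite expr0 mul0r addr0 mulr1.
apply: le_trans IH; rewrite exprSr -mulrA ler_wpM2l ?exprn_ge0 //.
rewrite -natr1 -subr_ge0 [leRHS](_ : _ = n.+1%:R * (1 - x) ^+ 2).
  by rewrite mulr_ge0 // sqr_ge0.
by rewrite -natr1; ring.
Qed.

(** Turns a geometric rate of convergence into a rate [1 / n]. *)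
Lemma expr_mul_succ_le x n : 0 <= x -> x < 1 -> x ^+ n * n.+1%:R <= (1 - x)^-1.
Proof.
move=> x0 x1; have h0 : 0 < 1 - x by rewrite subr_gt0.
rewrite -[leRHS]mul1r ler_pdivlMr // (le_trans _ (expr_bernoulli n x0 (ltW x1))) //.
by rewrite -mulrA ler_wpM2l ?exprn_ge0 // -natr1 mulrDl mul1r addrC lerD2r gerBl.
Qed.

(** Each step multiplies the left side by [(1 + 1 / n) ^ n <= expR 1] beyond
    the factor [n + 1]. *)
Lemma expn_self_le n : n%:R ^+ n <= expR 1 ^+ n * n`!%:R :> R.
Proof.
elim: n => [|n IH]; first by rewrite !expr0 mul1r.
rewrite exprS [leRHS](_ : _ = n.+1%:R * (expR 1 ^+ n * n`!%:R * expR 1)); last first.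
  by rewrite factS natrM exprS; ring.
rewrite ler_wpM2l //; case: n IH => [|n] IH.
  by rewrite !expr0 !mul1r (le_trans _ (expR_ge1Dx 1)) // lerDl.
apply: (@le_trans _ _ (n.+1%:R ^+ n.+1 * expR 1)); last by rewrite ler_wpM2r ?expR_ge0.
have -> : expR 1 = expR (n.+1%:R^-1) ^+ n.+1 :> R.
  by rewrite -expRM_natl mulfV // pnatr_eq0.
rewrite -exprMn lerXn2r ?nnegrE // ?mulr_ge0 ?expR_ge0 //.
rewrite (le_trans _ (ler_wpM2l _ (expR_ge1Dx _))) //.
by rewrite mulrDr mulfV ?pnatr_eq0 // mulr1 natr1.
Qed.

(** The ratio of the two sides decreases in [n], factor by factor, so the
    case [n = m] is the worst one. *)
Lemma expn_le_ffact n m : (m <= n)%N ->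
  n%:R ^+ m <= expR 1 ^+ m * (n ^_ m)%:R :> R.
Proof.
case: m => [|m] mn; first by rewrite !expr0 mul1r.
have H : (n ^ m.+1 * m.+1`! <= m.+1 ^ m.+1 * n ^_ m.+1)%N.
  rewrite -ffactnn !ffact_prod -[X in (X ^ _ * _)%N]card_ord.
  have pE c : (c ^ m.+1 = \prod_(i < m.+1) c)%N by rewrite prod_nat_const card_ord.
  rewrite card_ord !pE -!big_split /=; apply: leq_prod => i _.
  by rewrite !mulnBr mulnC leq_sub2l // leq_mul2r mn orbT.
have f0 : 0 < m.+1`!%:R :> R by rewrite ltr0n fact_gt0.
rewrite -(ler_pM2r f0) -natrX -natrM (le_trans (_ : _ <= (m.+1 ^ m.+1 * n ^_ m.+1)%N%:R)) ?ler_nat //.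
by rewrite natrM natrX mulrAC ler_wpM2r // expn_self_le.
Qed.

(** The ratio of the number of words of length [m] to the number of those
    with distinct letters. *)
Definition fall_ratio n m : R := n%:R ^+ m / (n ^_ m)%:R.

Lemma fall_ratio_le n m : (m <= n)%N -> fall_ratio n m <= expR 1 ^+ m.
Proof.
by move=> mn; rewrite ler_pdivrMr ?ltr0n ?ffact_gt0 // expn_le_ffact.
Qed.

Lemma fall_ratio_dist n m : (m <= n)%N ->
  0 <= fall_ratio n m - 1 <= m%:R ^+ 2 * expR 1 ^+ m / n%:R.
Proof.
elim: m => [|m IH] mn; first by rewrite /fall_ratio ffactn0 expr0 divr1 subrr expr0n !mul0r lexx.
have n0 : 0 < n%:R :> R by rewrite ltr0n; lia.
have step : fall_ratio n m.+1 - fall_ratio n m = fall_ratio n m.+1 * (m%:R / n%:R).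
  rewrite /fall_ratio exprSr ffactnSr natrM natrB; last lia.
  have f0 : (n ^_ m)%:R != 0 :> R by rewrite pnatr_eq0 -lt0n ffact_gt0 ltnW.
  have h0 : n%:R - m%:R != 0 :> R by rewrite subr_eq0 eqr_nat; lia.
  by field; rewrite f0 h0 (gt_eqF n0).
have p1 : fall_ratio n m.+1 <= expR 1 ^+ m.+1 := fall_ratio_le mn.
have p0 : 0 <= fall_ratio n m.+1 by rewrite divr_ge0 ?exprn_ge0.
have /andP[IH1 IH2] := IH (ltnW mn).
have -> : fall_ratio n m.+1 - 1 =
  fall_ratio n m.+1 * (m%:R / n%:R) + (fall_ratio n m - 1) by rewrite -step; ring.
apply/andP; split; first by rewrite addr_ge0 // mulr_ge0 // divr_ge0.
have E1 : 1 <= expR 1 :> R by rewrite (le_trans _ (expR_ge1Dx 1)) // lerDl.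
apply: (@le_trans _ _ (expR 1 ^+ m.+1 * (m%:R / n%:R) + m%:R ^+ 2 * expR 1 ^+ m.+1 / n%:R)).
  apply: lerD; first by rewrite ler_wpM2r // divr_ge0.
  apply: (le_trans IH2); rewrite ler_wpM2r ?invr_ge0 ?ler_wpM2l ?exprn_ge0 //.
  by rewrite exprS ler_peMl ?exprn_ge0 ?expR_ge0.
rewrite mulrA -mulrDl ler_wpM2r ?invr_ge0 //.
have : 0 <= expR 1 ^+ m.+1 :> R by rewrite exprn_ge0 ?expR_ge0.
rewrite -natr1; have : 0 <= m%:R :> R by [].
nra.
Qed.

End ElementaryBounds.

(** * Consequences of the growth rate *)

Section Growth.
Variables (R : realType) (k : nat) (r : R).
Hypothesis k_gt1 : (1 < k)%N.

Lemma fcount_gt0 n : (0 < fcount k n)%N.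
Proof.
apply/card_gt0P; exists 1%g; rewrite inE; apply/forallP => i; apply/negP.
case/andP => ikn /forallP H; have i1n : (i.+1 < n)%N by lia.
move: (H i) => /forallP/(_ (Ordinal i1n)); rewrite !perm1 /= leqnn eqxx.
by rewrite -addn1 ltn_add2l k_gt1 /=; lia.
Qed.

Definition scaled_count n : R := (fcount k n)%:R / (n`!%:R * r ^+ n).

(** Makes asymptotic bounds valid for all indices, so that the sums below need
    no splitting into small and large indices. *)
Lemma bounded_of_eventually (u : nat -> R) N (C : R) :
  (forall n, (N <= n)%N -> u n <= C) -> exists2 C' : R, 0 < C' & forall n, u n <= C'.
Proof.
move=> H; have S0 : 0 <= \sum_(i < N) `|u i| by exact: sumr_ge0.
(* The sum covers the finitely many indices below [N]. *)
exists (`|C| + 1 + \sum_(i < N) `|u i|).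
  by rewrite ltr_pwDl // ltr_wpDl.
move=> n; have [Nn|nN] := leqP N n.
  rewrite (le_trans (H n Nn)) // (le_trans (ler_norm C)) // -addrA lerDl.
  by rewrite addr_ge0.
rewrite (le_trans (ler_norm _)) // (bigD1 (Ordinal nN)) //= addrCA lerDl.
by rewrite !addr_ge0 // sumr_ge0.
Qed.

(** The lower bound [c0] at small indices uses that the counts are positive;
    the rate [1 / n] is a weak form of the exponential one, and is compatible
    with the shift of [n] by the total length of two blocks, since
    [1 / (n - m + 1) <= (m + 1) / n]. *)
Lemma growth_scaled_count : is_growth_rate k r -> exists c K c0 C0 : R,
  [/\ 0 < c0, 0 < C0, 0 < K, forall n, c0 <= scaled_count n <= C0 &
      forall n, `|scaled_count n - c| <= K / n.+1%:R].
Proof.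
move=> [r0 [c [g [c_gt0 g0 g1 [K0 [N HN]]]]]].
have f0 n : 0 < n`!%:R * r ^+ n by rewrite mulr_gt0 ?exprn_gt0 // ltr0n fact_gt0.
have d0 n : 0 < scaled_count n by rewrite divr_gt0 // ltr0n fcount_gt0.
have [K K_gt0 HK] : exists2 K, 0 < K & forall n, `|scaled_count n - c| * n.+1%:R <= K.
  apply: (@bounded_of_eventually _ N (c * (`|K0| * (1 - g)^-1))) => n Nn.
  have [e [eK fE]] := HN n Nn.
  have -> : scaled_count n - c = c * e.
    rewrite /scaled_count fE [X in X / _](_ : _ = c * (1 + e) * (n`!%:R * r ^+ n)); last by ring.
    by rewrite mulfK ?gt_eqF // mulrDr mulr1 addrC addKr.
  rewrite normrM (gtr0_norm c_gt0) -mulrA ler_wpM2l ?(ltW c_gt0) //.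
  apply: (@le_trans _ _ (`|K0| * g ^+ n * n.+1%:R)).
    rewrite ler_wpM2r // (le_trans eK) // ler_wpM2r ?exprn_ge0 //; exact: ler_norm.
  by rewrite -mulrA ler_wpM2l // expr_mul_succ_le.
have HK' n : `|scaled_count n - c| <= K / n.+1%:R by rewrite ler_pdivlMr.
have [X X_gt0 HX] : exists2 X, 0 < X & forall n, (scaled_count n)^-1 <= X.
  (* From this index on the distance to [c] is at most [c / 2]. *)
  apply: (@bounded_of_eventually _ (Num.bound (2 * K / c)) (2 / c)) => n Nn.
  have H : 2 * K / c < n.+1%:R.
    apply: (lt_le_trans (archi_boundP _)); first by rewrite divr_ge0 ?mulr_ge0 ?ltW.
    by rewrite ler_nat; apply: leqW.
  have H2 : K / n.+1%:R <= c / 2.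
    move: H; rewrite ltr_pdivrMr // ler_pdivrMr //; move: (n.+1%:R) => m; nra.
  have H3 : c / 2 <= scaled_count n by move: (HK' n) H2; rewrite ler_norml => /andP[+ _]; move: (K / _) => t; lra.
  rewrite -[2 / c]invf_div lef_pV2 ?posrE //; exact: divr_gt0.
exists c, K, X^-1, (c + K); split; rewrite ?invr_gt0 // ?addr_gt0 // => n.
rewrite -[X in _ <= X <= _]invrK lef_pV2 ?posrE ?invr_gt0 // HX /= invrK.
have K1 : K / n.+1%:R <= K by rewrite ler_pdivrMr // ler_peMr ?(ltW K_gt0) // ler1n.
by rewrite -lerBlDl (le_trans (ler_norm _)) // (le_trans (HK' n)).
Qed.

End Growth.

Section MainTerm.
Variable R : realType.

Lemma ffact_le_expn m i : (m ^_ i <= m ^ i)%N.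
Proof.
rewrite ffact_prod -[X in (_ <= _ ^ X)%N]card_ord -prod_nat_const.
by apply: leq_prod => t _; exact: leq_subr.
Qed.

Lemma expn_le_ffact_sub m i : ((m - i) ^ i <= m ^_ i)%N.
Proof.
rewrite ffact_prod -[X in (_ ^ X <= _)%N]card_ord -prod_nat_const.
by apply: leq_prod => t _; rewrite leq_sub2l // ltnW.
Qed.

(** Truncated subtraction is harmless, as it only increases the right side. *)
Lemma truncated_power_ge n m d i : (0 < n)%N -> (m <= n)%N ->
  (m%:R / n%:R) ^+ i - (i * d)%N%:R / n%:R <= ((m - d)%N%:R / n%:R) ^+ i :> R.
Proof.
move=> n0 mn; have n0' : 0 < n%:R :> R by rewrite ltr0n.
rewrite lerBlDr addrC -lerBlDr.
apply: le_trans (subr_expr_le _ _ _ _) _.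
- by rewrite divr_ge0.
- by rewrite ler_wpM2r ?invr_ge0 // ler_nat leq_subr.
- by rewrite ler_pdivrMr // mul1r ler_nat.
rewrite -mulrBl natrM -mulrA ler_wpM2l // ler_wpM2r ?invr_ge0 //.
by rewrite lerBlDr -natrD ler_nat; lia.
Qed.

(** Ordering the two blocks multiplies the count by [i! j!] and turns the
    binomial coefficients into falling factorials; divided by [n ^ (i + j)],
    these differ from the powers by [O(1 / n)]. *)
Lemma scaled_pairs_bound n p q i j N : (0 < n)%N -> (p <= n)%N -> (q <= n)%N ->
  (N <= 'C(p.-1, i) * 'C(q, j))%N ->
  ('C(p.-2, i) * 'C(q - i.+1, j) <= N)%N ->
  let X : R := (N * (i`! * j`!))%N%:R / n%:R ^+ (i + j) in
  0 <= X <= 1 /\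
  `|X - (p%:R / n%:R) ^+ i * (q%:R / n%:R) ^+ j| <= (i + j + 2)%N%:R ^+ 2 / n%:R.
Proof.
move=> n0 pn qn Nle Nge X; have n0' : 0 < n%:R :> R by rewrite ltr0n.
set u := (p%:R / n%:R) ^+ i; set v := (q%:R / n%:R) ^+ j.
have le1 m : (m <= n)%N -> 0 <= (m%:R / n%:R : R) <= 1.
  by move=> mn; rewrite divr_ge0 //= ler_pdivrMr // mul1r ler_nat.
have /andP[u0 u1] : 0 <= u <= 1.
  by have /andP[? ?] := le1 p pn; rewrite exprn_ge0 // exprn_ile1.
have /andP[v0 v1] : 0 <= v <= 1.
  by have /andP[? ?] := le1 q qn; rewrite exprn_ge0 // exprn_ile1.
have XE a b : (a ^ i * b ^ j)%N%:R / n%:R ^+ (i + j)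
    = (a%:R / n%:R) ^+ i * (b%:R / n%:R) ^+ j :> R.
  by rewrite natrM !natrX !expr_div_n exprD invfM; ring.
have Xu : X <= u * v.
  rewrite -XE ler_wpM2r ?invr_ge0 ?exprn_ge0 // ler_nat.
  apply: (@leq_trans (('C(p.-1, i) * i`!) * ('C(q, j) * j`!))).
    by rewrite mulnACA leq_mul2r Nle orbT.
  rewrite !bin_ffact leq_mul ?ffact_le_expn // (leq_trans (ffact_le_expn _ _)) //.
  by case: (i) => // i'; rewrite leq_exp2r // leq_pred.
have Xl : ((p - i.+2)%N%:R / n%:R) ^+ i * ((q - (i.+1 + j))%N%:R / n%:R) ^+ j <= X.
  rewrite -XE ler_wpM2r ?invr_ge0 ?exprn_ge0 // ler_nat.
  apply: (@leq_trans (('C(p.-2, i) * i`!) * ('C(q - i.+1, j) * j`!))); last first.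
    by rewrite mulnACA leq_mul2r Nge orbT.
  rewrite !bin_ffact leq_mul // (leq_trans _ (expn_le_ffact_sub _ _)) //.
    by rewrite (_ : p.-2 - i = p - i.+2)%N //; lia.
  by rewrite subnDA.
have X0 : 0 <= X by rewrite divr_ge0 ?exprn_ge0.
split; first by rewrite X0 (le_trans Xu) // mulr_ile1.
have Ul := truncated_power_ge i.+2 i n0 pn; have Vl := truncated_power_ge (i.+1 + j) j n0 qn.
rewrite -/u -/v in Ul Vl.
set u' := (X in _ <= X) in Ul; set v' := (X in _ <= X) in Vl.
have u'0 : 0 <= u' by rewrite exprn_ge0 // divr_ge0.
have v'0 : 0 <= v' by rewrite exprn_ge0 // divr_ge0.
rewrite distrC ger0_norm ?subr_ge0 //.
apply: (@le_trans _ _ (u * v - u' * v')); first by rewrite lerB.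
apply: (@le_trans _ _ ((i * i.+2)%N%:R / n%:R + (j * (i.+1 + j))%N%:R / n%:R)); last first.
  by rewrite -mulrDl ler_wpM2r ?invr_ge0 // -natrD -natrX ler_nat; clear; nia.
move: Ul Vl u'0 v'0 u0 v0 u1 v1.
set A := _ / n%:R; set B := _ / n%:R.
have A0 : 0 <= A by rewrite divr_ge0. 
have B0 : 0 <= B by rewrite divr_ge0.
move=> Ul Vl *.
have [uu|uu] := leP u u'.
  have : u * v' <= u' * v' by rewrite ler_wpM2r.
  have : u * (v - v') <= u * B by rewrite ler_wpM2l // lerBlDr addrC -lerBlDr.
  have : u * B <= B by rewrite ler_piMl.
  lra.
have : u * (v - v') <= u * B by rewrite ler_wpM2l // lerBlDr addrC -lerBlDr.
have : u * B <= B by rewrite ler_piMl.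
have v'1 : v' <= 1.
  by rewrite exprn_ile1 ?divr_ge0 // ler_pdivrMr // mul1r ler_nat (leq_trans (leq_subr _ _)).
have : (u - u') * v' <= (u - u') by rewrite ler_piMr // subr_ge0 ltW.
nra.
Qed.

End MainTerm.

(** * One term of the formula *)

Section TermEstimate.
Variables (R : realType) (k : nat) (r c K c0 C0 : R).
Hypotheses (k_gt1 : (1 < k)%N) (r_gt0 : 0 < r) (c0_gt0 : 0 < c0) (K_gt0 : 0 < K).
Hypothesis d_bounds : forall n, c0 <= scaled_count k r n <= C0.
Hypothesis d_rate : forall n, `|scaled_count k r n - c| <= K / n.+1%:R.

Lemma scaled_count_gt0 n : 0 < scaled_count k r n.
Proof. by apply: lt_le_trans c0_gt0 _; have /andP[] := d_bounds n. Qed.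

Lemma fcountE n : (fcount k n)%:R = scaled_count k r n * (n`!%:R * r ^+ n).
Proof. by rewrite divfK // mulf_neq0 ?expf_neq0 ?gt_eqF // ltr0n fact_gt0. Qed.

Lemma scaled_count_ratio n m : (0 < n)%N -> (m <= n)%N ->
  `|scaled_count k r (n - m) / scaled_count k r n - 1| <= K / c0 * (m + 2)%N%:R / n%:R.
Proof.
move=> n0 mn; have n0' : 0 < n%:R :> R by rewrite ltr0n.
have dn := scaled_count_gt0 n; have /andP[cd _] := d_bounds n.
have -> : scaled_count k r (n - m) / scaled_count k r n - 1
   = (scaled_count k r (n - m) - scaled_count k r n) / scaled_count k r n.
  by rewrite mulrBl divff ?gt_eqF.
rewrite normrM normfV (gtr0_norm dn) ler_pdivrMr //.
apply: (@le_trans _ _ (K * (m + 2)%N%:R / n%:R)); last first.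
  rewrite [leRHS](_ : _ = K * (m + 2)%N%:R / n%:R * (scaled_count k r n / c0)); last by ring.
  apply: ler_peMr; last by rewrite ler_pdivlMr // mul1r.
  by rewrite divr_ge0 // mulr_ge0 // ltW.
have -> : scaled_count k r (n - m) - scaled_count k r n
   = (scaled_count k r (n - m) - c) - (scaled_count k r n - c) by ring.
apply: (le_trans (ler_normB _ _)); apply: (le_trans (lerD (d_rate _) (d_rate _))).
rewrite -mulrDr -mulrA ler_wpM2l ?(ltW K_gt0) //.
apply: (@le_trans _ _ ((m + 1)%N%:R / n%:R + 1 / n%:R)); last first.
  by rewrite -mulrDl ler_wpM2r ?invr_ge0 // natr1 ler_nat; lia.
apply: lerD.
  by rewrite -[leLHS]mul1r ler_pdivrMr // mulrAC ler_pdivlMr // mul1r -natrM ler_nat; nia.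
by rewrite mul1r lef_pV2 ?posrE // ler_nat.
Qed.

(** In [term_estimate] the error has a factor [expR 1 ^ m] from [fall_ratio]
    and polynomial factors in the total length [m] of the two blocks; the
    latter are bounded by [4 ^ m]. *)
Definition term_const : R := K / c0 + 2.
Definition term_base : R := 4 * expR 1 / r.

Lemma term_base_gt0 : 0 < term_base.
Proof. by rewrite divr_gt0 // mulr_gt0 ?expR_gt0. Qed.

Lemma sqr_le_pow4 m : (m ^ 2 <= 4 ^ m)%N.
Proof. by rewrite -[4%N]/(2 ^ 2)%N -expnM mulnC expnM leq_exp2r // ltnW // ltn_expl. Qed.

Lemma addn2_le_pow4 m : (1 < m)%N -> (m + 2 <= 4 ^ m)%N.
Proof. by move=> m2; rewrite (leq_trans _ (sqr_le_pow4 m)) //; nia. Qed.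

(** The term is the product of three factors close to [1] or to the limit: the
    scaled number of pairs of blocks, [fall_ratio], and the ratio of scaled
    counts.  The factorials are kept in the bound because they make it
    summable over [i] and [j]. *)
Lemma term_estimate n p q i j N : (p <= n)%N -> (q <= n)%N ->
  (i + j + 2 <= n)%N ->
  (N <= 'C(p.-1, i) * 'C(q, j))%N ->
  ('C(p.-2, i) * 'C(q - i.+1, j) <= N)%N ->
  `| n%:R ^+ 2 * (N%:R * (fcount k (n - (i + j + 2)))%:R) / (fcount k n)%:R
     - ((p%:R / n%:R) ^+ i * (r ^+ i.+1)^-1 / i`!%:R) *
       ((q%:R / n%:R) ^+ j * (r ^+ j.+1)^-1 / j`!%:R) |
  <= term_const * (term_base ^+ i.+1 / i`!%:R) * (term_base ^+ j.+1 / j`!%:R) / n%:R.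
Proof.
move=> pn qn ijn Nle Nge; set m := (i + j + 2)%N.
have mE : m = (i.+1 + j.+1)%N by rewrite /m addn2 addnS.
have n0 : (0 < n)%N by rewrite (leq_trans _ ijn) // addn2.
have n0' : 0 < n%:R :> R by rewrite ltr0n.
pose X : R := (N * (i`! * j`!))%N%:R / n%:R ^+ (i + j).
set u := (p%:R / n%:R) ^+ i; set v := (q%:R / n%:R) ^+ j.
have [/andP[X0 X1] XE] : 0 <= X <= 1 /\ `|X - u * v| <= m%:R ^+ 2 / n%:R.
  exact: scaled_pairs_bound.
pose t := scaled_count k r (n - m) / scaled_count k r n.
have tE : `|t - 1| <= K / c0 * (m + 2)%N%:R / n%:R := scaled_count_ratio n0 ijn.
have pE : `|fall_ratio R n m - 1| <= m%:R ^+ 2 * expR 1 ^+ m / n%:R.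
  by have /andP[? ?] := fall_ratio_dist R ijn; rewrite ger0_norm.
have pm : fall_ratio R n m <= expR 1 ^+ m := fall_ratio_le R ijn.
have p0 : 0 <= fall_ratio R n m by rewrite divr_ge0 ?exprn_ge0.
pose W : R := (r ^+ m)^-1 / i`!%:R / j`!%:R.
have W0 : 0 <= W by rewrite !mulr_ge0 ?invr_ge0 ?exprn_ge0 ?(ltW r_gt0).
have i0 : i`!%:R != 0 :> R by rewrite pnatr_eq0 -lt0n fact_gt0.
have j0 : j`!%:R != 0 :> R by rewrite pnatr_eq0 -lt0n fact_gt0.
have rn0 : r != 0 by rewrite gt_eqF.
have rm a : r ^+ a != 0 by rewrite expf_neq0.
have -> : n%:R ^+ 2 * (N%:R * (fcount k (n - m))%:R) / (fcount k n)%:R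
   = X * fall_ratio R n m * t * W.
  rewrite /X /t /W /fall_ratio !fcountE -(ffact_fact ijn) -/m.
  have -> : n%:R ^+ m = n%:R ^+ (i + j) * n%:R ^+ 2 :> R by rewrite -exprD.
  have -> : r ^+ n = r ^+ m * r ^+ (n - m) by rewrite -exprD subnKC.
  have f1 : (n ^_ m)%:R != 0 :> R by rewrite pnatr_eq0 -lt0n ffact_gt0.
  have f2 : (n - m)`!%:R != 0 :> R by rewrite pnatr_eq0 -lt0n fact_gt0.
  have f3 : n%:R ^+ (i + j) != 0 :> R by rewrite expf_neq0 // gt_eqF.
  have f4 : scaled_count k r n != 0 by rewrite gt_eqF // scaled_count_gt0.
  rewrite !natrM; move: f3 (rm m) (rm (n - m)%N).
  move: (n%:R ^+ (i + j)) (r ^+ m) (r ^+ (n - m)) => A B C A0 B0 C0'.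
  by field; rewrite ?i0 ?j0 ?A0 ?B0 ?C0' ?f1 ?f2 ?f4.
have -> : u * (r ^+ i.+1)^-1 / i`!%:R * (v * (r ^+ j.+1)^-1 / j`!%:R) = u * v * W.
  by rewrite /W mE exprD invfM; ring.
rewrite -mulrBl normrM (ger0_norm W0).
have -> : term_const * (term_base ^+ i.+1 / i`!%:R) * (term_base ^+ j.+1 / j`!%:R) / n%:R
    = term_const * (4 ^+ m * expR 1 ^+ m) / n%:R * W.
  rewrite /W /term_base -exprMn mE.
  by rewrite !expr_div_n !exprD invfM; ring.
rewrite ler_wpM2r //.
have E1 : 1 <= expR 1 ^+ m :> R.
  by rewrite exprn_ege1 // (le_trans _ (expR_ge1Dx 1)) // lerDl.
have m4 : m%:R ^+ 2 <= 4 ^+ m :> R by rewrite -!natrX ler_nat sqr_le_pow4.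
have m4' : (m + 2)%N%:R <= 4 ^+ m :> R.
  by rewrite -natrX ler_nat addn2_le_pow4 // /m addn2.
have -> : X * fall_ratio R n m * t - u * v =
  X * (fall_ratio R n m * (t - 1)) + X * (fall_ratio R n m - 1) + (X - u * v) by ring.
apply: (le_trans (ler_normD _ _)); apply: (le_trans (lerD (ler_normD _ _) (lexx _))).
clearbody X; rewrite !(normrM X) (normrM (fall_ratio R n m) (t - 1)).
rewrite (ger0_norm X0) (ger0_norm p0).
set En := expR 1 ^+ m in pE pm E1 *.
have En0 : 0 <= En by rewrite exprn_ge0 ?expR_ge0.
apply: (@le_trans _ _ (En * (K / c0 * 4 ^+ m / n%:R) + 4 ^+ m * En / n%:R + 4 ^+ m * En / n%:R)); last first.
  by rewrite /term_const le_eqVlt; apply/orP; left; apply/eqP; ring.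
have nV0 : 0 <= n%:R^-1 :> R by rewrite invr_ge0.
have Kc0 : 0 <= K / c0 by rewrite divr_ge0 ?ltW.
apply: lerD; first apply: lerD.
- apply: (@le_trans _ _ (1 * (En * (K / c0 * 4 ^+ m / n%:R)))); last by rewrite mul1r.
  apply: ler_pM => //; first by rewrite mulr_ge0.
  apply: ler_pM => //; apply: (le_trans tE).
  by rewrite ler_wpM2r // ler_wpM2l.
- apply: (@le_trans _ _ (1 * (4 ^+ m * En / n%:R))); last by rewrite mul1r.
  apply: ler_pM => //; apply: (le_trans pE).
  by rewrite ler_wpM2r // ler_wpM2r.
- apply: (le_trans XE); rewrite ler_wpM2r //.
  by rewrite (le_trans m4) // ler_peMr ?exprn_ge0.
Qed.

End TermEstimate.

(** * The series phi *)

Section PhiSeries.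
Variables (R : realType) (k : nat) (r : R).
Hypotheses (k_gt1 : (1 < k)%N) (r_gt0 : 0 < r).
Implicit Types x : R.

Lemma block_sign_norm i : `|block_sign R k i| <= 1.
Proof.
by rewrite /block_sign; case: (k %| i)%N; case: (k %| i.+1)%N;
  rewrite ?subrr ?subr0 ?sub0r ?normr0 ?normrN ?normr1 // ler01.
Qed.

Lemma phi_coeffE i : phi_coeff R k i = block_sign R k i / i`!%:R.
Proof.
rewrite /phi_coeff /block_sign; case ki: (k %| i)%N.
  have -> : (k %| i.+1)%N = false.
    by rewrite -addn1 dvdn_addr // dvdn1; apply/eqP => k1; move: k_gt1; rewrite k1.
  by rewrite subr0 mul1r.
by case: (k %| i.+1)%N; rewrite ?subrr ?mul0r // sub0r mulNr mul1r.
Qed.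

Definition phi_term i x : R := x ^+ i * (r ^+ i.+1)^-1 / i`!%:R.
Definition phi_partial n x : R := \sum_(i < n) block_sign R k i * phi_term i x.

Lemma phi_partialE n x :
  phi_partial n x = r^-1 * pseries (phi_coeff R k) (x / r) n.
Proof.
rewrite /pseries /series /= big_mkord mulr_sumr; apply: eq_bigr => i _.
rewrite phi_coeffE /phi_term expr_div_n exprS invfM; ring.
Qed.

Lemma phi_partial_cvg x : phi_partial n x @[n --> \oo] --> phi k r x.
Proof.
rewrite (_ : (fun n => _) = (fun n => r^-1 * pseries (phi_coeff R k) (x / r) n)); last first.
  by apply/funext => n; rewrite phi_partialE.
apply: cvgMr; apply: normed_cvg.
apply: (series_le_cvg (v_ := exp_coeff `|x / r|)) => [n|n|n|].
- exact: normr_ge0.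
- by rewrite exp_coeff_ge0.
- rewrite /= phi_coeffE /exp_coeff /= !normrM normrX normfV normr_nat -mulrA.
  rewrite [_^-1 * _]mulrC normrM ler_piMl ?block_sign_norm //.
- exact: is_cvg_series_exp_coeff.
Qed.

Lemma phi_term_ge0 i x : 0 <= x -> 0 <= phi_term i x.
Proof. by move=> x0; rewrite !mulr_ge0 ?invr_ge0 ?exprn_ge0 // ltW. Qed.

Lemma phi_term_le i x : 0 <= x <= 1 -> phi_term i x <= r^-1 * (r^-1 ^+ i / i`!%:R).
Proof.
move=> /andP[x0 x1]; rewrite /phi_term exprS invfM exprVn mulrA.
rewrite ler_wpM2r ?invr_ge0 // ler_piMl ?mulr_ge0 ?invr_ge0 ?exprn_ge0 ?(ltW r_gt0) //.
by rewrite exprn_ile1.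
Qed.

Lemma phi_dist_partial x n C :
  (forall m, (n <= m)%N -> `|phi_partial m x - phi_partial n x| <= C) ->
  `|phi k r x - phi_partial n x| <= C.
Proof.
move=> H; apply: (@cvgr_to_le _ \oo _ _ (fun m => `|phi_partial m x - phi_partial n x|)).
  by apply: cvg_norm; apply: cvgB; [exact: phi_partial_cvg | exact: cvg_cst].
by exists n => // m /=; exact: H.
Qed.

Definition phi_bound : R := r^-1 * expR r^-1.

Lemma phi_partial_le n x : 0 <= x <= 1 -> `|phi_partial n x| <= phi_bound.
Proof.
move=> x01; apply: le_trans (ler_norm_sum _ _ _) _.
apply: (@le_trans _ _ (\sum_(i < n) r^-1 * (r^-1 ^+ i / i`!%:R))).
  apply: ler_sum => i _; apply: le_trans (phi_term_le i x01).
  rewrite normrM (ger0_norm (phi_term_ge0 _ _)); last by case/andP: x01.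
  by rewrite ler_piMl ?block_sign_norm // phi_term_ge0 //; case/andP: x01.
rewrite -mulr_sumr ler_wpM2l ?invr_ge0 ?(ltW r_gt0) //.
by rewrite exp_partial_sum_le // invr_ge0 ltW.
Qed.

Lemma phi_le x : 0 <= x <= 1 -> `|phi k r x| <= phi_bound.
Proof.
move=> x01; have p0 : phi_partial 0 x = 0 by rewrite /phi_partial big_ord0.
have := @phi_dist_partial x 0 phi_bound; rewrite p0 subr0; apply => m _.
by rewrite subr0 phi_partial_le.
Qed.

(** For [i >= n] a term is at most [i / n] times itself, and [i <= 2 ^ i]. *)
Lemma phi_tail x n : 0 <= x <= 1 -> (0 < n)%N ->
  `|phi k r x - phi_partial n x| <= r^-1 * expR (2 / r) / n%:R.
Proof.
move=> x01 n0; apply: phi_dist_partial => m nm.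
have n0' : 0 < n%:R :> R by rewrite ltr0n.
have r0 := ltW r_gt0; have x0 : 0 <= x by case/andP: x01.
rewrite /phi_partial -!(big_mkord xpredT (fun i => block_sign R k i * phi_term i x)).
rewrite (big_cat_nat (leq0n n) nm) /= addrAC subrr add0r.
apply: le_trans (ler_norm_sum _ _ _) _.
apply: (@le_trans _ _ (\sum_(n <= i < m) r^-1 * ((2 / r) ^+ i / i`!%:R) / n%:R)).
  apply: ler_sum_nat => i /andP[ni im].
  rewrite normrM (ger0_norm (phi_term_ge0 _ x0)).
  apply: (@le_trans _ _ (phi_term i x)); first by rewrite ler_piMl ?block_sign_norm ?phi_term_ge0.
  apply: (le_trans (phi_term_le i x01)); rewrite ler_pdivlMr // -mulrA ler_wpM2l ?invr_ge0 //.
  rewrite expr_div_n exprVn mulrAC ler_wpM2r ?invr_ge0 // mulrC ler_wpM2r ?invr_ge0 ?exprn_ge0 //.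
  by rewrite -natrX ler_nat (leq_trans ni) // ltnW // ltn_expl.
rewrite -mulr_suml ler_wpM2r ?invr_ge0 // -mulr_sumr ler_wpM2l ?invr_ge0 //.
have y0 : 0 <= 2 / r by rewrite divr_ge0.
apply: le_trans (exp_partial_sum_le m y0).
rewrite -(big_mkord xpredT (fun i => (2 / r) ^+ i / i`!%:R)).
rewrite (big_cat_nat (leq0n n) nm) /= lerDr.
by rewrite big_nat; apply: sumr_ge0 => i _; rewrite divr_ge0 ?exprn_ge0.
Qed.

Lemma phi_partial_lipschitz x y n : 0 <= y -> y <= x -> x <= 1 ->
  `|phi_partial n x - phi_partial n y| <= r^-1 * expR (2 / r) * (x - y).
Proof.
move=> y0 yx x1; have r0 := ltW r_gt0; have x0 := le_trans y0 yx.
rewrite /phi_partial -sumrB; apply: le_trans (ler_norm_sum _ _ _) _.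
apply: (@le_trans _ _ (\sum_(i < n) r^-1 * ((2 / r) ^+ i / i`!%:R) * (x - y))).
  apply: ler_sum => i _; rewrite -mulrBr normrM.
  apply: (@le_trans _ _ `|phi_term i x - phi_term i y|).
    by rewrite ler_piMl ?block_sign_norm.
  rewrite /phi_term -mulrBl -mulrBl exprS invfM.
  rewrite ger0_norm; last first.
    by rewrite !mulr_ge0 ?invr_ge0 ?exprn_ge0 // subr_ge0 lerXn2r // nnegrE.
  rewrite [leLHS](_ : _ = r^-1 * (r^-1 ^+ i / i`!%:R * (x ^+ i - y ^+ i))); last first.
    by rewrite exprVn; ring.
  rewrite -[leRHS]mulrA ler_wpM2l ?invr_ge0 // expr_div_n -exprVn.
  rewrite [leRHS](_ : _ = r^-1 ^+ i / i`!%:R * (2 ^+ i * (x - y))); last by ring.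
  rewrite ler_wpM2l ?divr_ge0 ?exprn_ge0 ?invr_ge0 //.
  apply: (le_trans (subr_expr_le i y0 yx x1)); rewrite ler_wpM2r ?subr_ge0 //.
  by rewrite -natrX ler_nat ltnW // ltn_expl.
rewrite -mulr_suml -mulr_sumr ler_wpM2r ?subr_ge0 // ler_wpM2l ?invr_ge0 //.
by rewrite exp_partial_sum_le // divr_ge0.
Qed.

Lemma phi_lipschitz x y : 0 <= y -> y <= x -> x <= 1 ->
  `|phi k r x - phi k r y| <= r^-1 * expR (2 / r) * (x - y).
Proof.
move=> y0 yx x1.
apply: (@cvgr_to_le _ \oo _ _ (fun m => `|phi_partial m x - phi_partial m y|)).
  by apply: cvg_norm; apply: cvgB; exact: phi_partial_cvg.
by exists 0%N => // m _; exact: phi_partial_lipschitz.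
Qed.

End PhiSeries.

(** * The additive estimate *)

Section MainEstimate.
Variables (R : realType) (k : nat) (r c K c0 C0 : R).
Hypotheses (k_gt1 : (1 < k)%N) (r_gt0 : 0 < r) (c0_gt0 : 0 < c0) (K_gt0 : 0 < K).
Hypothesis d_bounds : forall n, c0 <= scaled_count k r n <= C0.
Hypothesis d_rate : forall n, `|scaled_count k r n - c| <= K / n.+1%:R.

Let Q : R := term_base r.
Let K2 : R := term_const K c0.

(** Terms of the product of series that have no counterpart in the exact
    formula are small because [1 <= (i + j + 2) / n]. *)
Lemma term_tail n i j (u v : R) : (0 < n)%N -> 0 <= u <= 1 -> 0 <= v <= 1 ->
  (n < i + j + 2)%N ->
  phi_term r i u * phi_term r j v
  <= K2 * (Q ^+ i.+1 / i`!%:R) * (Q ^+ j.+1 / j`!%:R) / n%:R.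
Proof.
move=> n0 u01 v01 nij; have n0' : 0 < n%:R :> R by rewrite ltr0n.
have r0 : 0 <= r^-1 by rewrite invr_ge0 ltW.
apply: (@le_trans _ _ ((r^-1 ^+ i.+1 / i`!%:R) * (r^-1 ^+ j.+1 / j`!%:R))).
  apply: ler_pM.
  - by apply: phi_term_ge0 => //; case/andP: u01.
  - by apply: phi_term_ge0 => //; case/andP: v01.
  - by rewrite exprS -mulrA phi_term_le.
  - by rewrite exprS -mulrA phi_term_le.
rewrite ler_pdivlMr // /Q /term_base !(exprMn _ _ r^-1).
set a := r^-1 ^+ i.+1; set b := r^-1 ^+ j.+1.
set A := 4 * expR 1.
rewrite [leRHS](_ : _ = a / i`!%:R * (b / j`!%:R) * (K2 * A ^+ (i.+1 + j.+1))); last first.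
  by rewrite exprD; ring.
rewrite ler_wpM2l //.
  by rewrite !mulr_ge0 ?invr_ge0 // exprn_ge0.
have E1 : 1 <= expR 1 :> R by rewrite (le_trans _ (expR_ge1Dx 1)) // lerDl.
have K21 : 1 <= K2.
  have : 0 <= K / c0 by rewrite divr_ge0 ?ltW.
  by rewrite /K2 /term_const; move: (K / c0) => t; lra.
apply: (@le_trans _ _ (A ^+ (i.+1 + j.+1))); last first.
  by rewrite ler_peMl // exprn_ge0 // mulr_ge0 ?expR_ge0.
apply: (@le_trans _ _ (4 ^+ (i.+1 + j.+1))).
  rewrite -natrX ler_nat (leq_trans (ltnW nij)) // addn2 -addnS -addSn.
  by rewrite ltnW // ltn_expl.
by rewrite lerXn2r ?nnegrE // ?mulr_ge0 ?expR_ge0 // ler_peMr.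
Qed.

(** [n ^ 3 <= 8 ^ n] leaves a term of the exponential series. *)
Lemma single_block_small n (b : bool) : (0 < n)%N ->
  `|n%:R ^+ 2 * (block_sign R k n.-1 * b%:R) / (fcount k n)%:R|
  <= expR (8 / r) / c0 / n%:R.
Proof.
move=> n0; have n0' : 0 < n%:R :> R by rewrite ltr0n.
have /andP[dc _] := d_bounds n; have d0 : 0 < scaled_count k r n := lt_le_trans c0_gt0 dc.
have f0 : 0 < n`!%:R * r ^+ n by rewrite mulr_gt0 ?exprn_gt0 // ltr0n fact_gt0.
rewrite normrM normfV normrM normrX !normr_nat.
apply: (@le_trans _ _ (n%:R ^+ 2 / (fcount k n)%:R)).
  rewrite ler_wpM2r ?invr_ge0 // ler_piMr ?exprn_ge0 //.
  rewrite normrM -[leRHS]mulr1; apply: ler_pM => //; first exact: block_sign_norm.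
  by case: b; rewrite ?normr1 ?normr0.
rewrite (fcountE k r_gt0) invfM ler_pdivlMr //.
rewrite [leLHS](_ : _ = n%:R ^+ 3 / (n`!%:R * r ^+ n) * (scaled_count k r n)^-1); last by ring.
apply: ler_pM; rewrite ?invr_ge0 ?(ltW d0) //.
- by rewrite divr_ge0 ?exprn_ge0 // ltW.
- have y0 : 0 <= 8 / r by rewrite divr_ge0 // ltW.
  apply: le_trans (exp_partial_sum_le n.+1 y0).
  rewrite big_ord_recr /= (le_trans _ (ler_wpDl (sumr_ge0 _ _) (lexx _))) //; last first.
    by move=> i _; rewrite divr_ge0 ?exprn_ge0.
  rewrite expr_div_n invfM mulrA mulrAC ler_wpM2r ?invr_ge0 //.
  rewrite ler_wpM2r ?invr_ge0 ?exprn_ge0 ?(ltW r_gt0) // -!natrX ler_nat.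
  rewrite -[8%N]/(2 ^ 3)%N -expnM mulnC expnM leq_exp2r //.
  by rewrite ltnW // ltn_expl.
- by rewrite lef_pV2 // posrE.
Qed.

(** Both [phi] are truncated at [n] terms, so that the exact formula and the
    product of partial sums are compared term by term. *)
Lemma ends_estimate : exists A : R, forall n (x y : 'I_n), x != y ->
  `|n%:R ^+ 2 * (fcount_ends k x.+1 y.+1 n)%:R / (fcount k n)%:R -
    phi k r (x.+1%:R / n%:R) * phi k r ((n - y.+1)%N%:R / n%:R)| <= A / n%:R.
Proof.
pose B := phi_bound r; pose D := r^-1 * expR (2 / r).
exists (expR (8 / r) / c0 + K2 * (Q * expR Q) ^+ 2 + (D * B + B * D)).
move=> n x y xy; have n0 : (0 < n)%N by exact: leq_ltn_trans (ltn_ord x).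
have n0' : 0 < n%:R :> R by rewrite ltr0n.
set u := x.+1%:R / n%:R; set v := (n - y.+1)%N%:R / n%:R.
have u01 : 0 <= u <= 1 by rewrite divr_ge0 //= ler_pdivrMr // mul1r ler_nat.
have v01 : 0 <= v <= 1 by rewrite divr_ge0 //= ler_pdivrMr // mul1r ler_nat leq_subr.
have Q0 : 0 <= Q by rewrite ltW // term_base_gt0.
have K20 : 0 <= K2 by rewrite addr_ge0 // divr_ge0 ?ltW.
pose P m w := phi_partial k r m w.
set L := _ / _; have HL : `|L - P n u * P n v|
    <= expR (8 / r) / c0 / n%:R + K2 * (Q * expR Q) ^+ 2 / n%:R.
  have [b bE] := fcount_ends_formula R x y k_gt1.
  pose T i j : R := n%:R ^+ 2 * ((pointed_pairs x y i j)%:R *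
     (fcount k (n - (i + j + 2)))%:R) / (fcount k n)%:R.
  have -> : L = n%:R ^+ 2 * (block_sign R k n.-1 * b%:R) / (fcount k n)%:R +
     \sum_(i < n) \sum_(j < n) block_sign R k i * block_sign R k j *
       (if (i + j + 2 <= n)%N then T i j else 0).
    rewrite /L bE mulrDr mulrDl; congr (_ + _); rewrite mulr_sumr mulr_suml.
    apply: eq_bigr => i _; rewrite mulr_sumr mulr_suml big_mkcond.
    apply: eq_bigr => j _; case: ifP => _; last by rewrite mulr0.
    by rewrite /T; ring.
  rewrite /P /phi_partial big_distrlr /= -addrA -sumrB.
  apply: (le_trans (ler_normD _ _)); apply: lerD; first exact: single_block_small.
  apply: (le_trans (ler_norm_sum _ _ _)).
  pose q i : R := Q ^+ i.+1 / i`!%:R.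
  apply: (@le_trans _ _ (\sum_(i < n) \sum_(j < n) K2 * q i * q j / n%:R)).
    apply: ler_sum => i _; rewrite -sumrB; apply: (le_trans (ler_norm_sum _ _ _)).
    apply: ler_sum => j _.
    rewrite [X in `|X|](_ : _ = block_sign R k i * block_sign R k j *
      ((if (i + j + 2 <= n)%N then T i j else 0) - phi_term r i u * phi_term r j v)); last by ring.
    rewrite normrM (le_trans (_ : _ <= 1 * `|(if (i + j + 2 <= n)%N then T i j else 0)
        - phi_term r i u * phi_term r j v|)) //.
      rewrite ler_wpM2r // normrM -[leRHS]mulr1; apply: ler_pM => //; exact: block_sign_norm.
    rewrite mul1r; case: leqP => ij.
      apply: (term_estimate k_gt1 r_gt0 c0_gt0 K_gt0 d_bounds d_rate) => //.
      - exact: leq_subr.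
      - exact: pointed_pairs_le.
      - exact: pointed_pairs_ge.
    rewrite sub0r normrN ger0_norm; first exact: term_tail.
    apply: mulr_ge0; apply: phi_term_ge0 => //; [by case/andP: u01 | by case/andP: v01].
  under eq_bigr do rewrite -mulr_suml -mulr_sumr.
  rewrite -mulr_suml ler_wpM2r ?invr_ge0 // -mulr_suml -mulr_sumr -mulrA.
  rewrite ler_wpM2l //.
  have q0 : 0 <= \sum_(i < n) q i.
    by apply: sumr_ge0 => i _; rewrite divr_ge0 ?exprn_ge0.
  have qQ : \sum_(i < n) q i <= Q * expR Q.
    rewrite /q; under eq_bigr do rewrite exprS -mulrA.
    by rewrite -mulr_sumr ler_wpM2l // exp_partial_sum_le.
  by rewrite expr2; apply: ler_pM.
have tu := phi_tail k_gt1 r_gt0 u01 n0; have tv := phi_tail k_gt1 r_gt0 v01 n0.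
rewrite -/D -/(P n u) -/(P n v) in tu tv.
have -> : L - phi k r u * phi k r v = (L - P n u * P n v)
   - ((phi k r u - P n u) * phi k r v + P n u * (phi k r v - P n v)) by ring.
apply: (le_trans (ler_normB _ _)); rewrite [leRHS]mulrDl; apply: lerD.
  by apply: (le_trans HL); rewrite -mulrDl.
apply: (le_trans (ler_normD _ _)); rewrite (normrM (phi k r u - P n u)) (normrM (P n u)) [leRHS]mulrDl.
apply: lerD.
  rewrite [leRHS]mulrAC; apply: ler_pM => //; exact: (phi_le k_gt1 r_gt0 v01).
rewrite -[leRHS]mulrA; apply: ler_pM => //; exact: (phi_partial_le k r_gt0 n u01).
Qed.

End MainEstimate.

(** * Convolution with an absolutely summable sequence *)

Section Convolution.
Variable R : realType.
Implicit Types w a g : nat -> R.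

Lemma sum_convolution w a n :
  \sum_(m < n) \sum_(i < m.+1) w i * a (m - i)%N =
  \sum_(i < n) w i * \sum_(l < n - i) a l.
Proof.
elim: n => [|n IH]; first by rewrite !big_ord0.
rewrite big_ord_recr IH [in RHS]big_ord_recr /= subSnn big_ord1.
rewrite [X in _ + X]big_ord_recr /= subnn addrA; congr (_ + _).
rewrite -big_split; apply: eq_bigr => i _ /=; have il := ltn_ord i.
by rewrite subSn 1?ltnW // big_ord_recr mulrDr.
Qed.

Lemma cvg_of_abs_bounded w (B : R) : (forall n, \sum_(i < n) `|w i| <= B) ->
  cvgn (fun n => \sum_(i < n) w i).
Proof.
move=> HB; rewrite (_ : (fun n => _) = series w); last first.
  by apply/funext => n; rewrite /series /= big_mkord.
apply: normed_cvg; rewrite (_ : [normed series w] = fun n => \sum_(i < n) `|w i|); last first.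
  by apply/funext => n; rewrite /normed_series_of /series /= big_mkord.
apply: nondecreasing_is_cvgn.
  by apply/nondecreasing_seqP => n; rewrite big_ord_recr /= lerDl.
by exists B => _ [n _ <-].
Qed.

(** The indices [i] close to [n], where [g (n - i)] is far from its limit, meet
    a tail of the summable sequence [w]. *)
Lemma cvg_convolution w g (B l : R) : (forall n, \sum_(i < n) `|w i| <= B) ->
  g n @[n --> \oo] --> l ->
  \sum_(i < n) w i * g (n - i)%N @[n --> \oo]
    --> limn (fun n => \sum_(i < n) w i) * l.
Proof.
move=> HB gl; have wc := cvg_of_abs_bounded HB.
have B0 : 0 <= B by have := HB 0%N; rewrite big_ord0.
have HB' n : \sum_(i < n) `|(`|w i|)| <= B.
  by under eq_bigr do rewrite normr_id; exact: HB.
have nc : cvgn (fun n => \sum_(i < n) `|w i|) :=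
  @cvg_of_abs_bounded (fun i => `|w i|) B HB'.
have [D D0 HD] : exists2 D, 0 < D & forall m, `|g m - l| <= D.
  have /cvgrPdist_le/(_ 1 ltr01) [N _ HN] := gl.
  apply: (@bounded_of_eventually R (fun m => `|g m - l|) N 1) => m Nm.
  by rewrite distrC; exact: HN.
suff E0 : (fun n => \sum_(i < n) w i * (g (n - i)%N - l)) @ \oo --> (0 : R).
  rewrite (_ : (fun n => _) = (fun n => \sum_(i < n) w i * (g (n - i)%N - l) +
      (\sum_(i < n) w i) * l)); last first.
    apply/funext => n; rewrite mulr_suml -big_split; apply: eq_bigr => i _ /=.
    by rewrite -mulrDr subrK.
  rewrite -[X in _ --> X]add0r; apply: cvgD => //; apply: cvgMl; exact: wc.
apply/cvgrPdist_le => e e0.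
have e1 : 0 < e / 2 / (B + 1) by rewrite !divr_gt0 // ltr_wpDl.
have e2 : 0 < e / 2 / D by rewrite !divr_gt0.
have /cvgrPdist_le/(_ _ e1) [M1 _ HM1] := gl.
have /cvgrPdist_le/(_ _ e2) [M2 _ HM2] := nc.
exists (M1 + M2)%N => // n /= Mn.
rewrite sub0r normrN (le_trans (ler_norm_sum _ _ _)) //.
under eq_bigr do rewrite normrM.
rewrite -(big_mkord xpredT (fun i => `|w i| * `|g (n - i)%N - l|)).
rewrite (big_cat_nat (leq0n (n - M1)) (leq_subr _ _)) /= [leRHS](splitr e).
apply: lerD.
  apply: (@le_trans _ _ (\sum_(0 <= i < n - M1) `|w i| * (e / 2 / (B + 1)))).
    apply: ler_sum_nat => i /andP[_ iM]; rewrite ler_wpM2l // distrC.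
    by apply: HM1 => /=; lia.
  rewrite -mulr_suml big_mkord.
  apply: (@le_trans _ _ (B * (e / 2 / (B + 1)))).
    by rewrite ler_wpM2r ?HB // ltW.
  rewrite mulrA ler_pdivrMr ?ltr_wpDl // mulrC ler_wpM2l ?divr_ge0 ?(ltW e0) //.
  by rewrite lerDl.
apply: (@le_trans _ _ (\sum_(n - M1 <= i < n) `|w i| * D)).
  by apply: ler_sum_nat => i _; rewrite ler_wpM2l.
rewrite -mulr_suml -ler_pdivlMr //.
have mono : {homo (fun n => \sum_(i < n) `|w i|) : n m / (n <= m)%N >-> n <= m}.
  by apply/nondecreasing_seqP => m; rewrite big_ord_recr /= lerDl.
have H1 := nondecreasing_cvgn_le mono nc n.
have H2 : (M2 <= n - M1)%N by clear -Mn; lia.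
have := HM2 _ H2; rewrite ger0_norm ?subr_ge0 ?nondecreasing_cvgn_le // => H3.
apply: le_trans H3; rewrite lerBrDr; apply: le_trans H1.
rewrite -!(big_mkord xpredT (fun i => `|w i|)).
by rewrite [leRHS](big_cat_nat (leq0n (n - M1)) (leq_subr _ _)) /= addrC.
Qed.

End Convolution.

(** * Positivity of phi *)

Lemma succ_mul_pow_fact (R : realType) (y : R) i :
  i.+1%:R * (y ^+ i.+1 / i.+1`!%:R) = y * (y ^+ i / i`!%:R).
Proof.
have p0 : i.+1%:R != 0 :> R by rewrite pnatr_eq0.
rewrite exprS factS natrM invfM; move: (i.+1%:R) p0 (y ^+ i) (i`!%:R^-1) => p p0 Y F.
by transitivity (p * p^-1 * (y * (Y * F))); [ring | rewrite divff // mul1r].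
Qed.

Section Positivity.
Variables (R : realType) (k : nat) (r c0 C0 : R).
Hypotheses (k_gt1 : (1 < k)%N) (r_gt0 : 0 < r) (c0_gt0 : 0 < c0).
Hypothesis d_bounds : forall n, c0 <= scaled_count k r n <= C0.

Lemma scaled_count_rec n : scaled_count k r n.+1 =
  \sum_(i < n.+1) block_sign R k i * (r^-1 ^+ i.+1 / i.+1`!%:R)
     * scaled_count k r (n - i).
Proof.
rewrite /scaled_count fcount_rec // mulr_suml; apply: eq_bigr => i _; have il := ltn_ord i.
have f0 m : m`!%:R != 0 :> R by rewrite pnatr_eq0 -lt0n fact_gt0.
have r0 m : r ^+ m != 0 by rewrite expf_neq0 // gt_eqF.
have := bin_fact (n := n.+1) (m := i.+1) il; rewrite subSS => <-.
have -> : r ^+ n.+1 = r ^+ i.+1 * r ^+ (n - i) by rewrite -exprD addSn subnKC.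
have b0 : 'C(n.+1, i.+1)%:R != 0 :> R by rewrite pnatr_eq0 -lt0n bin_gt0.
rewrite exprVn; move: (f0 i.+1) (f0 (n - i)%N) (r0 i.+1) (r0 (n - i)%N) b0.
move: (i.+1`!) ((n - i)`!) (r ^+ i.+1) (r ^+ (n - i)) ('C(n.+1, i.+1)) => A B C D E.
by rewrite !natrM => A0 B0 C0' D0 E0; field; rewrite A0 B0 C0' D0 E0.
Qed.

(** In this section [S] and [H] are the partial sums of [G(z)] and of
    [z G'(z)], and [s] those of [z (1 / (1 - z))'], to which [H] is compared. *)
Section Interior.
Variable z : R.
Hypotheses (z_gt0 : 0 < z) (z_lt1 : z < 1).

Let a n := scaled_count k r n * z ^+ n.
Let w i := block_sign R k i * ((z / r) ^+ i.+1 / i.+1`!%:R).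
Let S n := \sum_(l < n) a l.
Let H n := \sum_(l < n) l%:R * a l.
Let s n := \sum_(l < n) l%:R * z ^+ l.

Let a_rec n : a n.+1 = \sum_(i < n.+1) w i * a (n - i).
Proof.
rewrite /a scaled_count_rec mulr_suml; apply: eq_bigr => i _; have il := ltn_ord i.
have -> : z ^+ n.+1 = z ^+ i.+1 * z ^+ (n - i) by rewrite -exprD addSn subnKC.
by rewrite /w expr_div_n -exprVn; ring.
Qed.

Let S_rec n : S n.+1 = a 0 + \sum_(i < n) w i * S (n - i).
Proof.
rewrite {1}/S big_ord_recl; congr (_ + _).
by rewrite -sum_convolution; apply: eq_bigr => m _; exact: a_rec.
Qed.

Let H_rec n : H n.+1 = \sum_(i < n) (i.+1%:R * w i) * S (n - i)
   + \sum_(i < n) w i * H (n - i).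
Proof.
rewrite {1}/H big_ord_recl mul0r add0r.
rewrite /S /H -(sum_convolution (fun i => i.+1%:R * w i)) -(sum_convolution w (fun l => l%:R * a l)) -big_split.
apply: eq_bigr => m _; rewrite /bump /= ?add1n a_rec mulr_sumr -big_split.
apply: eq_bigr => i _ /=; have im := ltn_ord i.
have -> : m.+1%:R = i.+1%:R + (m - i)%:R :> R by rewrite -natrD; congr (_%:R); lia.
by ring.
Qed.

Let a_ge0 n : 0 <= a n.
Proof.
rewrite mulr_ge0 ?exprn_ge0 ?(ltW z_gt0) //.
by have /andP[/(lt_le_trans c0_gt0)/ltW] := d_bounds n.
Qed.

Let zr_ge0 : 0 <= z / r. Proof. by rewrite divr_ge0 ?ltW. Qed.

Let w_bound n : \sum_(i < n) `|i.+1%:R * w i| <= z / r * expR (z / r).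
Proof.
apply: (@le_trans _ _ (\sum_(i < n) z / r * ((z / r) ^+ i / i`!%:R))).
  apply: ler_sum => i _; rewrite normrM normr_nat /w normrM.
  rewrite mulrCA (le_trans (ler_piMl _ (block_sign_norm R k i))) ?mulr_ge0 //.
  rewrite ger0_norm ?divr_ge0 ?exprn_ge0 //.
  by rewrite succ_mul_pow_fact.
by rewrite -mulr_sumr ler_wpM2l // exp_partial_sum_le.
Qed.

Let w_bound' n : \sum_(i < n) `|w i| <= z / r * expR (z / r).
Proof.
apply: le_trans (w_bound n); apply: ler_sum => i _.
by rewrite [leRHS]normrM normr_nat ler_peMl // ler1n.
Qed.

Let geom_cvg : (fun n => \sum_(l < n) z ^+ l) @ \oo --> (1 - z)^-1.
Proof.
rewrite (_ : (fun n => _) = series (geometric 1 z)); last first.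
  by apply/funext => n; rewrite /series /= big_mkord; apply: eq_bigr => l _; rewrite mul1r.
rewrite -[X in _ --> X]mul1r; apply: cvg_geometric_series.
by rewrite ger0_norm ?(ltW z_gt0).
Qed.

Let geom_le n : \sum_(l < n) z ^+ l <= (1 - z)^-1.
Proof.
rewrite -[leLHS]/((fun n => \sum_(l < n) z ^+ l) n).
rewrite -(cvg_lim (@Rhausdorff R) geom_cvg).
apply: nondecreasing_cvgn_le; last by apply: cvgP geom_cvg.
by apply/nondecreasing_seqP => m; rewrite big_ord_recr /= lerDl exprn_ge0 // ltW.
Qed.

Let s_closed n : s n * (1 - z) ^+ 2 = z - z ^+ n * (n%:R * (1 - z) + z).
Proof.
elim: n => [|n IH]; first by rewrite /s big_ord0 expr0 !mul0r add0r mul1r subrr.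
rewrite /s big_ord_recr -/(s n) mulrDl IH /= (exprS z n) -natr1; ring.
Qed.

Let s_le n : s n <= z / (1 - z) ^+ 2.
Proof.
have z1 : 0 < 1 - z by rewrite subr_gt0.
rewrite ler_pdivlMr ?exprn_gt0 // s_closed gerBl.
by rewrite mulr_ge0 ?exprn_ge0 ?addr_ge0 ?mulr_ge0 ?(ltW z_gt0) ?(ltW z1).
Qed.

Let ndS : nondecreasing_seq S.
Proof. by apply/nondecreasing_seqP => n; rewrite /S big_ord_recr /= lerDl. Qed.

Let ndH : nondecreasing_seq H.
Proof. by apply/nondecreasing_seqP => n; rewrite /H big_ord_recr /= lerDl mulr_ge0. Qed.

Let nds : nondecreasing_seq s.
Proof.
apply/nondecreasing_seqP => n; rewrite /s big_ord_recr /= lerDl.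
by rewrite mulr_ge0 // exprn_ge0 // ltW.
Qed.

Let C0_gt0 : 0 < C0.
Proof. by have /andP[/(lt_le_trans c0_gt0) + ?] := d_bounds 0; move=> /lt_le_trans; apply. Qed.

Let S_le n : S n <= C0 / (1 - z).
Proof.
apply: (@le_trans _ _ (\sum_(l < n) C0 * z ^+ l)).
  apply: ler_sum => l _; rewrite ler_wpM2r ?exprn_ge0 ?(ltW z_gt0) //.
  by have /andP[] := d_bounds l.
by rewrite -mulr_sumr ler_wpM2l ?(ltW C0_gt0).
Qed.

Let H_le n : H n <= C0 * (z / (1 - z) ^+ 2).
Proof.
apply: (@le_trans _ _ (\sum_(l < n) C0 * (l%:R * z ^+ l))).
  apply: ler_sum => l _; rewrite mulrCA ler_wpM2r ?mulr_ge0 ?exprn_ge0 ?(ltW z_gt0) //.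
  by have /andP[] := d_bounds l.
rewrite -mulr_sumr ler_wpM2l ?(ltW C0_gt0) //; exact: s_le.
Qed.

Let H_ge n : c0 * s n <= H n.
Proof.
rewrite mulr_sumr; apply: ler_sum => l _.
rewrite mulrCA ler_wpM2l // ler_wpM2r ?exprn_ge0 ?(ltW z_gt0) //.
by have /andP[] := d_bounds l.
Qed.

Let cvgS : cvgn S.
Proof.
by apply: nondecreasing_is_cvgn ndS _; exists (C0 / (1 - z)) => _ [n _ <-].
Qed.

Let cvgH : cvgn H.
Proof.
by apply: nondecreasing_is_cvgn ndH _; exists (C0 * (z / (1 - z) ^+ 2)) => _ [n _ <-].
Qed.

Let cvgs : cvgn s.
Proof.
by apply: nondecreasing_is_cvgn nds _; exists (z / (1 - z) ^+ 2) => _ [n _ <-].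
Qed.

Let s_lim : limn s = z / (1 - z) ^+ 2.
Proof.
have sE : (fun n => s n.+1) = (fun n => z * s n + z * \sum_(l < n) z ^+ l).
  apply/funext => n; rewrite /s big_ord_recl mul0r add0r !mulr_sumr -big_split.
  apply: eq_bigr => l _; rewrite /bump /= ?add1n exprS -natr1; ring.
have L1 : (fun n => s n.+1) @ \oo --> limn s by rewrite cvg_shiftS.
have L2 : (fun n => s n.+1) @ \oo --> z * limn s + z * (1 - z)^-1.
  by rewrite sE; apply: cvgD; apply: cvgMr.
have := cvg_unique (@Rhausdorff R) L1 L2; move: (limn s) => T TE.
have z1 : 1 - z != 0 by rewrite subr_eq0 gt_eqF.
have : T * (1 - z) = z / (1 - z) by rewrite mulrBr mulr1 {1}TE; ring.
by move=> E; rewrite expr2 invfM mulrA -E mulfK.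
Qed.

(** In the limit the recurrences for [S] and [H] read [G = a 0 + W G] and
    [HH = z phi(z) G + W HH]; eliminating [W] gives
    [HH * a 0 = z phi(z) G ^ 2]. *)
Lemma phi_interior_ge : c0 ^+ 2 / C0 ^+ 2 <= phi k r z.
Proof.
have z1 : 0 < 1 - z by rewrite subr_gt0.
set G := limn S; set HH := limn H; pose W := limn (fun n => \sum_(i < n) w i).
have GE : G = a 0 + W * G.
  have L1 : (fun n => S n.+1) @ \oo --> G by rewrite cvg_shiftS.
  apply: (cvg_unique (@Rhausdorff R) L1).
  rewrite (_ : (fun n => _) = (fun n => a 0 + \sum_(i < n) w i * S (n - i))); last first.
    by apply/funext => n; exact: S_rec.
  by apply: cvgD; [exact: cvg_cst | exact: cvg_convolution w_bound' cvgS].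
have ZE : limn (fun n => \sum_(i < n) i.+1%:R * w i) = z * phi k r z.
  apply: (cvg_lim (@Rhausdorff R)).
  rewrite (_ : (fun n => _) = (fun n => z * phi_partial k r n z)); last first.
    apply/funext => n; rewrite /phi_partial mulr_sumr; apply: eq_bigr => i _.
    rewrite /w mulrCA succ_mul_pow_fact /phi_term expr_div_n exprS invfM.
    by ring.
  by apply: cvgMr; exact: phi_partial_cvg.
have HE : HH = z * phi k r z * G + W * HH.
  have L1 : (fun n => H n.+1) @ \oo --> HH by rewrite cvg_shiftS.
  apply: (cvg_unique (@Rhausdorff R) L1).
  rewrite (_ : (fun n => _) = (fun n => \sum_(i < n) (i.+1%:R * w i) * S (n - i)
      + \sum_(i < n) w i * H (n - i))); last first.
    by apply/funext => n; exact: H_rec.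
  by apply: cvgD; [rewrite -ZE; exact: (@cvg_convolution _ (fun i => i.+1%:R * w i) S _ _ w_bound cvgS)
                  | exact: cvg_convolution w_bound' cvgH].
have HG : HH * a 0 = z * phi k r z * G ^+ 2.
  have a0E : a 0 = G - W * G by rewrite {1}GE addrK.
  have zE : z * phi k r z * G = HH - W * HH by rewrite {1}HE addrK.
  by rewrite expr2 mulrA zE a0E; ring.
have a0c : c0 <= a 0.
  by rewrite /a expr0 mulr1; have /andP[] := d_bounds 0.
have G1 : G <= C0 / (1 - z).
  by apply: limr_le => //; exists 0%N.
have G0 : 0 < G.
  apply: (lt_le_trans c0_gt0); apply: (le_trans a0c).
  have := nondecreasing_cvgn_le ndS cvgS 1; by rewrite {1}/S big_ord1.
have HH1 : c0 * (z / (1 - z) ^+ 2) <= HH.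
  rewrite -s_lim; apply: (@ler_cvg_to _ \oo _ _ (fun n => c0 * s n) H) => //.
    by apply: cvgMr.
  by exists 0%N.
have C01 := C0_gt0.
have HH2 : c0 ^+ 2 * (z / (1 - z) ^+ 2) <= z * phi k r z * G ^+ 2.
  rewrite -HG expr2 mulrAC; apply: ler_pM => //; last exact: ltW.
  by rewrite mulr_ge0 ?divr_ge0 ?exprn_ge0 // ltW.
have G2 : G ^+ 2 <= (C0 / (1 - z)) ^+ 2.
  by rewrite lerXn2r // ?nnegrE ?divr_ge0 ?(ltW G0) ?(ltW C01) ?(ltW z1).
have phi0 : 0 < phi k r z.
  have : 0 < z * phi k r z * G ^+ 2.
    by apply: lt_le_trans HH2; rewrite mulr_gt0 ?divr_gt0 ?exprn_gt0.
  by rewrite pmulr_lgt0 ?exprn_gt0 // pmulr_rgt0.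
have : c0 ^+ 2 * (z / (1 - z) ^+ 2) <= z * phi k r z * (C0 / (1 - z)) ^+ 2.
  by apply: (le_trans HH2); rewrite ler_wpM2l // mulr_ge0 // ltW.
rewrite ler_pdivrMr ?exprn_gt0 // => E.
(* The common factor of the two comparisons with the geometric series. *)
have q0 : 0 < z / (1 - z) ^+ 2 by rewrite divr_gt0 ?exprn_gt0.
rewrite -(ler_pM2r q0) (le_trans E) // expr_div_n le_eqVlt; apply/orP; left.
by apply/eqP; ring.
Qed.

End Interior.

(** A point [0] or [1] is approached by interior points at distance [t]. *)
Lemma phi_ge x : 0 <= x <= 1 -> c0 ^+ 2 / C0 ^+ 2 <= phi k r x.
Proof.
move=> /andP[x0 x1]; apply/ler_addgt0Pr => e e0.
pose L := r^-1 * expR (2 / r).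
have L0 : 0 < L by rewrite mulr_gt0 ?invr_gt0 ?expR_gt0.
pose t := Num.min (1 / 2) (e / L).
have t0 : 0 < t by rewrite lt_min !divr_gt0.
have tL : L * t <= e by rewrite mulrC -ler_pdivlMr // ge_min lexx orbT.
have t1 : t <= 1 / 2 by rewrite ge_min lexx.
have [xh|xh] := leP x (1 / 2).
  have [->|x_neq0] := eqVneq x 0.
    have := phi_lipschitz k_gt1 r_gt0 (lexx 0) (ltW t0) (_ : t <= 1).
    rewrite subr0 -/L => /(_ ltac:(lra)) D.
    have := phi_interior_ge t0 (_ : t < 1) => /(_ ltac:(lra)).
    by move: D; rewrite ler_norml => /andP[]; lra.
  have xp : 0 < x by rewrite lt_def x_neq0.
  have x_lt1 : x < 1 by lra.
  by rewrite (le_trans (phi_interior_ge xp x_lt1)) // lerDl ltW.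
have y0 : 0 < x - t by lra.
have y1 : x - t < 1 by lra.
have := phi_lipschitz k_gt1 r_gt0 (ltW y0) (_ : x - t <= x) x1.
rewrite -/L => /(_ ltac:(lra)); rewrite ler_norml => /andP[D _].
have := phi_interior_ge y0 y1.
have E : L * (x - (x - t)) = L * t by congr (_ * _); ring.
by move: D; rewrite E; lra.
Qed.

End Positivity.

Local Close Scope classical_set_scope.

(** * Conclusion *)

Theorem theorem6p3 (R : realType) (k : nat) (hk : (3 <= k)%N)
    (r : R) (hr : is_growth_rate k r) :
  exists (K : R) (N : nat), forall n m1 m2 : nat,
    (N <= n)%N -> (1 <= m1 <= n)%N -> (1 <= m2 <= n)%N -> m1 <> m2 ->
    exists e : R, `|e| <= K * n%:R `^ (- (49%:R / 100%:R)) /\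
      n%:R ^+ 2 * (fcount_ends k m1 m2 n)%:R / (fcount k n)%:R
        = phi k r (m1%:R / n%:R) * phi k r (1 - m2%:R / n%:R) * (1 + e).
Proof.
have k1 : (1 < k)%N by exact: leq_trans hk.
have r0 : 0 < r by case: hr.
have [c [K [c0 [C0 [c0_gt0 C0_gt0 K_gt0 d_bounds d_rate]]]]] := growth_scaled_count k1 hr.
have [A HA] := ends_estimate k1 r0 c0_gt0 K_gt0 d_bounds d_rate.
pose d := c0 ^+ 2 / C0 ^+ 2; have d0 : 0 < d by rewrite divr_gt0 ?exprn_gt0.
exists (`|A| / d ^+ 2), 1%N => n m1 m2 n0 /andP[m1_gt0 m1n] /andP[m2_gt0 m2n] m12.
have n0' : 0 < n%:R :> R by rewrite ltr0n.
have x_lt : (m1.-1 < n)%N by rewrite prednK.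
have y_lt : (m2.-1 < n)%N by rewrite prednK.
have xy : Ordinal x_lt != Ordinal y_lt.
  by apply/eqP => -[E]; apply: m12; rewrite -(prednK m1_gt0) E prednK.
have := HA n _ _ xy; rewrite /= !prednK // natrB // mulrBl divff ?gt_eqF //.
set u := m1%:R / n%:R; set v := 1 - m2%:R / n%:R.
set ratio := _ * _ / _; move=> HE.
have u01 : 0 <= u <= 1 by rewrite divr_ge0 //= ler_pdivrMr // mul1r ler_nat.
have v01 : 0 <= v <= 1.
  by rewrite subr_ge0 gerBl divr_ge0 // ler_pdivrMr // mul1r ler_nat m2n.
have pu := phi_ge k1 r0 c0_gt0 d_bounds u01; have pv := phi_ge k1 r0 c0_gt0 d_bounds v01.
have pp : d ^+ 2 <= phi k r u * phi k r v by rewrite expr2 ler_pM // ltW.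
have pp0 : 0 < phi k r u * phi k r v by apply: lt_le_trans pp; rewrite exprn_gt0.
exists (ratio / (phi k r u * phi k r v) - 1); split; last first.
  by rewrite addrC subrK mulrC divfK // gt_eqF.
rewrite -[X in _ - X](divff (lt0r_neq0 pp0)) -mulrBl normrM normfV (gtr0_norm pp0).
apply: (@le_trans _ _ (`|A| / n%:R / d ^+ 2)).
  apply: ler_pM => //; first by rewrite invr_ge0 ltW.
    by rewrite (le_trans HE) // ler_wpM2r ?invr_ge0 ?ler_norm.
  by rewrite lef_pV2 // posrE // exprn_gt0.
rewrite mulrAC ler_wpM2l ?divr_ge0 ?exprn_ge0 ?(ltW d0) //.
rewrite -(powR_inv1 (ltW n0')) ler_powR ?ler1n //; lra.
Qed.
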